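(* Let $n\ge 2$, $\mu>0$, let $X^{(\mu)}$ be the hyperbolic Brownian motion with drift on $\mathbb{H}^n$ starting from $x\in D=\{x\in\mathbb{H}^n:x_1>0\}$, and let $\tau_D=\inf\{t>0:X^{(\mu)}_t\notin D\}$. Define $$Z^{(\mu)}_t=\begin{cases}X^{(\mu)}_t, & \tau_D>t,\\ \overline{X^{(\mu)}_t}, & \tau_D\le t.\end{cases}$$ Then the processes $\{Z^{(\mu)}_t\}_{t\ge 0}$ and $\{X^{(\mu)}_t\}_{t\ge 0}$ have the same law.
   Context: $\mathbb{H}^n=\{x=(x_1,\dots,x_n)\in\mathbb{R}^n:x_n>0\}$. For $x\in\mathbb{R}^n$, $\bar x=(-x_1,x_2,\dots,x_n)$; thus $\overline{X^{(\mu)}_t}$ is $X^{(\mu)}_t$ with the sign of its first coordinate changed. For $\mu>0$, $X^{(\mu)}$ is the diffusion on $\mathbb{H}^n$ with generator $\frac12\Delta_\mu$, where $\Delta_\mu=x_n^2\sum_{k=1}^n\frac{\partial^2}{\partial x_k^2}-(2\mu-1)x_n\frac{\partial}{\partial x_n}$. Equivalently, in law, $X^{(\mu)}_t=(\beta(A_t),Y_t)$, where $Y_t=x_n\exp(B_t-\mu t)$ with $B$ a standard one-dimensional Brownian motion, $A_t=\int_0^tY_s^2\,ds$, and $\beta$ is an $(n-1)$-dimensional Brownian motion independent of $B$ starting from $(x_1,\dots,x_{n-1})$. *)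

(* Defs.v *)
From HB Require Import structures.
From mathcomp Require Import all_boot all_order all_algebra.
From mathcomp Require Import all_classical all_reals all_analysis.
Set Implicit Arguments.
Unset Strict Implicit.
Unset Printing Implicit Defensive.
Import Order.TTheory GRing.Theory Num.Theory.
Import numFieldNormedType.Exports.
Local Open Scope classical_set_scope.
Local Open Scope ring_scope.

(* Processes are written X : R -> Omega -> S, first argument the time; only
   the times t >= 0 are meaningful, and every notion below ignores t < 0. *)

Section path_space.
Context {R : realType}.

(* The Borel sigma-algebra of R^n, as a product of n copies of that of R. *)
Definition borel_rV (n : nat) : set_system 'rV[R]_n :=
  g_sigma_preimage (fun (i : 'I_n) (x : 'rV[R]_n) => x ord0 i).

(* The product sigma-algebra on S^[0,+oo[, where M is the sigma-algebra of S. *)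
Definition path_sigma (S : Type) (M : set_system S) : set_system (R -> S) :=
  <<s [set C | exists t A,
         [/\ 0 <= t, M A & C = [set p : R -> S | A (p t)]] ] >>.

End path_space.

Section processes.
Context {R : realType} {d : measure_display} {Omega : measurableType d}.

Definition sample_path (S : Type) (X : R -> Omega -> S) : Omega -> R -> S :=
  fun w t => X t w.

Definition is_process (S : Type) (M : set_system S) (X : R -> Omega -> S) :=
  forall t A, 0 <= t -> M A -> measurable (X t @^-1` A).

Definition continuous_paths (S : topologicalType) (X : R -> Omega -> S) :=
  forall w, {within `[0, +oo[, continuous (sample_path X w)}.

(* sigma(X_t, t >= 0) *)
Definition sigma_process (S : Type) (M : set_system S) (X : R -> Omega -> S) :
    set_system Omega :=
  preimage_set_system setT (sample_path X) (path_sigma M).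

Definition law (P : probability Omega R) (S : Type) (X : R -> Omega -> S) :
    set (R -> S) -> \bar R :=
  fun E => P (sample_path X @^-1` E).

Definition independent2 (P : probability Omega R) (G H : set_system Omega) :=
  forall E F, G E -> H F -> P (E `&` F) = (P E * P F)%E.

Definition mutually_independent (P : probability Omega R) (I : finType)
    (G : I -> set_system Omega) :=
  forall (J : {set I}) (E : I -> set Omega), (forall i, i \in J -> G i (E i)) ->
    P (\bigcap_(i in [set` J]) E i) = (\prod_(i in J) P (E i))%E.

(* The second argument of normal_prob is the standard deviation. *)
Definition brownian_motion (P : probability Omega R) (b : R)
    (B : R -> Omega -> R) : Prop :=
  [/\ is_process measurable B,
      continuous_paths B,
      P [set w | B 0 w = b] = 1%E,
      (forall s t A, 0 <= s -> s < t -> measurable A ->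
         P [set w | A (B t w - B s w)] = normal_prob 0 (Num.sqrt (t - s)) A) &
      (forall (k : nat) (t : nat -> R), 0 <= t 0%N ->
         (forall i, (i < k)%N -> t i <= t i.+1) ->
         mutually_independent P (fun i : 'I_k =>
           g_sigma_algebra_preimage (fun w => B (t i.+1) w - B (t i) w)))].

Definition brownian_motion_rV (P : probability Omega R) (n : nat)
    (b : 'rV[R]_n) (B : R -> Omega -> 'rV[R]_n) : Prop :=
  (forall i, brownian_motion P (b ord0 i) (fun t w => B t w ord0 i)) /\
  mutually_independent P (fun i : 'I_n =>
    sigma_process measurable (fun t w => B t w ord0 i)).

End processes.

Definition same_law {R : realType} {d d' : measure_display}
    {Omega : measurableType d} {Omega' : measurableType d'}
    (S : Type) (M : set_system S)
    (P : probability Omega R) (X : R -> Omega -> S)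
    (P' : probability Omega' R) (X' : R -> Omega' -> S) : Prop :=
  [/\ is_process M X, is_process M X' &
      forall E, path_sigma M E -> law P X E = law P' X' E].

(* R^n with n >= 2 is 'rV[R]_m.+2, n = m + 2: x_1 is x ord0 ord0, x_n is
   x ord0 ord_max, and (x_1, ..., x_(n-1)) is horizontal x : 'rV[R]_m.+1. *)
Section hyperbolic_space.
Context {R : realType} {m : nat}.

Definition half_space : set 'rV[R]_m.+2 := [set x | 0 < x ord0 ord_max].

Definition quarter_space : set 'rV[R]_m.+2 :=
  half_space `&` [set x | 0 < x ord0 ord0].

Definition reflection (x : 'rV[R]_m.+2) : 'rV[R]_m.+2 :=
  \row_i (if i == ord0 then - x ord0 i else x ord0 i).

Definition horizontal (x : 'rV[R]_m.+2) : 'rV[R]_m.+1 :=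
  \row_j x ord0 (lift ord_max j).

Definition hyp_point (u : 'rV[R]_m.+1) (y : R) : 'rV[R]_m.+2 :=
  \row_i (if unlift ord_max i is Some j then u ord0 j else y).

End hyperbolic_space.

Section time_change.
Context {R : realType} {d : measure_display} {Omega : measurableType d}.

(* Y_t = y exp(B_t - mu t) *)
Definition vertical (mu y : R) (B : R -> Omega -> R) (t : R) (w : Omega) : R :=
  y * expR (B t w - mu * t).

(* A_t = int_0^t Y_s^2 ds *)
Definition clock (mu y : R) (B : R -> Omega -> R) (t : R) (w : Omega) : R :=
  \int[lebesgue_measure]_(s in `[0, t]) (vertical mu y B s w ^+ 2).

(* (beta(A_t), Y_t) *)
Definition time_changed (m : nat) (mu y : R) (beta : R -> Omega -> 'rV[R]_m.+1)
    (B : R -> Omega -> R) (t : R) (w : Omega) : 'rV[R]_m.+2 :=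
  hyp_point (beta (clock mu y B t w) w) (vertical mu y B t w).

End time_change.

Section hyperbolic_brownian_motion.
Context {R : realType} {d : measure_display} {Omega : measurableType d}.

(* X is a version of the diffusion on H^n with generator (1/2) Delta_mu,
     Delta_mu = x_n^2 sum_k d^2/dx_k^2 - (2 mu - 1) x_n d/dx_n,
   started at x: a continuous H^n-valued process with the law of
   (beta(A_t), Y_t). The Brownian motions beta and B may live on another
   probability space. *)
Definition hyperbolic_brownian_motion (m : nat) (P : probability Omega R)
    (mu : R) (x : 'rV[R]_m.+2) (X : R -> Omega -> 'rV[R]_m.+2) : Prop :=
  [/\ continuous_paths X,
      (forall t w, 0 <= t -> half_space (X t w)) &
      exists (d' : measure_display) (Omega' : measurableType d')
        (P' : probability Omega' R) (B : R -> Omega' -> R)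
        (beta : R -> Omega' -> 'rV[R]_m.+1),
        [/\ brownian_motion P' 0 B,
            brownian_motion_rV P' (horizontal x) beta,
            independent2 P' (sigma_process (@borel_rV R m.+1) beta)
                            (sigma_process measurable B) &
            same_law (@borel_rV R m.+2) P X
              P' (time_changed mu (x ord0 ord_max) beta B)]].

(* tau_D = inf {t > 0 : X_t notin D}, +oo if X never leaves D. *)
Definition exit_time (S : Type) (D : set S) (X : R -> Omega -> S) (w : Omega) :
    \bar R :=
  ereal_inf [set t%:E | t in [set t : R | 0 < t /\ ~ D (X t w)]].

Definition reflected_at_exit (m : nat) (X : R -> Omega -> 'rV[R]_m.+2)
    (t : R) (w : Omega) : 'rV[R]_m.+2 :=
  if (t%:E < exit_time quarter_space X w)%E then X t w
  else reflection (X t w).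

End hyperbolic_brownian_motion.

(* Main.v *)
From HB Require Import structures.
Require Import Defs.
From mathcomp Require Import all_boot all_order all_algebra.
From mathcomp Require Import all_classical all_reals all_analysis.
From mathcomp Require Import measurable_realfun lra.
Import Order.TTheory GRing.Theory Num.Theory.
Import numFieldNormedType.Exports.
Local Open Scope classical_set_scope.
Local Open Scope ring_scope.

(* Call a law on paths mirror invariant when, for every fixed time s, it is
   unchanged by flipping the increments of the first coordinate after s.

   A Brownian motion is mirror invariant, because its increments are independent
   and symmetric.  So is (beta(A_t), Y_t): given B, flipping the first coordinate
   after time s amounts to flipping beta after the time A_s, and A is independent
   of beta.  Conditioning is avoided by rounding A down to the grid Z/(N+1), which
   leaves countably many values, and letting N tend to infinity.

   Mirror invariance at fixed times yields the reflection principle without any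
   Markov property.  Let tau_N be the first point of the grid Z/(N+1) after tau_D.
   Whether tau_N = k/(N+1) can be read off the path before k/(N+1), hence also off
   the path flipped at k/(N+1); summing over k, flipping X at the random time tau_N
   preserves its law.  As N tends to infinity tau_N decreases to tau_D, where the
   first coordinate vanishes, so the flipped paths converge pointwise to Z. *)

Set Implicit Arguments.
Unset Strict Implicit.
Unset Printing Implicit Defensive.

(** * Laws of real families *)

(** Generators of the product sigma-algebra on [R^I], for an index type of any cardinality; open
    rays suffice because they generate the Borel sets of [R]. *)
Definition rays (R : realType) (I : Type) : set_system (I -> R) :=
  [set C | exists i a, C = [set p : I -> R | a < p i]].

Definition real_family (R : realType) (I : Type) :=
  g_sigma_algebraType (@rays R I).

HB.instance Definition _ (R : realType) (I : Type) :=
  Measurable.on (real_family R I).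

(** The list may repeat an index, so that intersection is concatenation and cylinders form a
    pi-system. The inequalities are strict, hence stable under small perturbations, which the limit
    argument needs. *)
Definition cylinder (R : realType) (I : Type) (s : seq (I * R)) :
    set (real_family R I) :=
  [set p | all (fun q => q.2 < p q.1) s].

Definition eq_law (R : realType) d d' (T : measurableType d)
    (T' : measurableType d') (P : probability T R) (P' : probability T' R)
    dS (S : measurableType dS) (f : T -> S) (f' : T' -> S) : Prop :=
  forall E, measurable E -> P (f @^-1` E) = P' (f' @^-1` E).

(** Sets on which the two image measures agree form a Dynkin system, so a generating pi-system
    decides. *)
Lemma eq_law_dynkin (R : realType) d d' (T : measurableType d)
    (T' : measurableType d') (P : probability T R) (P' : probability T' R)
    dS (S : measurableType dS) (G : set_system S) (f : T -> S) (f' : T' -> S) :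
  @measurable _ S = <<s G >> -> setI_closed G ->
  measurable_fun setT f -> measurable_fun setT f' ->
  (forall A, G A -> P (f @^-1` A) = P' (f' @^-1` A)) ->
  eq_law P P' f f'.
Proof.
move=> mG GI mf mf' ff' E mE.
have pm A : measurable A -> measurable (f @^-1` A).
  by move=> mA; rewrite -[X in measurable X]setTI; exact: mf.
have pm' A : measurable A -> measurable (f' @^-1` A).
  by move=> mA; rewrite -[X in measurable X]setTI; exact: mf'.
have sE : <<s G >> E by rewrite -mG.
move: E sE {mE}; apply: (dynkin_induction mG) => //.
- by rewrite !preimage_setT !probability_setT.
- move=> A mA PA; rewrite -!preimage_setC.
  by rewrite (probability_setC P (pm _ mA)) (probability_setC P' (pm' _ mA)) PA.
- move=> F mF tF PF.
  have tFp (U : Type) (g : U -> S) : trivIset setT (fun n => g @^-1` F n).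
    move=> i j _ _ [w [Fi Fj]]; apply: (tF i j) => //.
    by exists (g w).
  rewrite !preimage_bigcup.
  rewrite (measure_semi_bigcup P (fun i => pm _ (mF i))); first last.
  + by apply: bigcup_measurable => i _; exact: pm.
  + exact: tFp.
  rewrite (measure_semi_bigcup P' (fun i => pm' _ (mF i))); first last.
  + by apply: bigcup_measurable => i _; exact: pm'.
  + exact: tFp.
  by apply: eq_eseriesr => n _; exact: PF.
Qed.

Section families.
Context (R : realType) (I : Type).

Lemma measurable_coord (i : I) :
  measurable_fun [set: real_family R I] (fun p : real_family R I => p i : R).
Proof.
move=> mT; apply: (measurability _ (RGenOInfty.measurableE R)) => //.
move=> /= _ [_ [a ->] <-]; rewrite setTI; apply: sub_sigma_algebra.
exists i, a; apply/seteqP; split => p /=; rewrite in_itv/= andbT //.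
Qed.

Lemma measurable_family d (T : measurableType d) (f : T -> real_family R I) :
  (forall i, measurable_fun [set: T] (fun w => f w i : R)) ->
  measurable_fun [set: T] f.
Proof.
move=> mf; apply: (@measurability _ _ T (real_family R I) setT f (@rays R I) erefl).
move=> _ [_ [i [a ->]] <-]; rewrite setTI.
have := mf i measurableT `]a, +oo[%classic (measurable_itv _).
rewrite setTI; congr measurable.
by apply/seteqP; split => w /=; rewrite in_itv/= andbT.
Qed.

Lemma cylinder_cat (s t : seq (I * R)) :
  cylinder s `&` cylinder t = cylinder (s ++ t).
Proof.
by apply/seteqP; split => p /=; rewrite /cylinder/= all_cat => /andP.
Qed.

Lemma cylinder_cons (q : I * R) (t : seq (I * R)) :
  cylinder (q :: t) = [set p | q.2 < p q.1] `&` cylinder t.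
Proof. by apply/seteqP; split => p /=; rewrite /cylinder/= => /andP. Qed.

Lemma cylinder_nil : cylinder [::] = [set: real_family R I].
Proof. by apply/seteqP; split. Qed.

Lemma measurable_cylinder (s : seq (I * R)) : measurable (cylinder s).
Proof.
elim: s => [|q s IH]; first by rewrite cylinder_nil.
rewrite cylinder_cons; apply: measurableI => //.
by apply: sub_sigma_algebra; exists q.1, q.2.
Qed.

Lemma measurable_cylinders :
  @measurable _ (real_family R I) = <<s range (@cylinder R I) >>.
Proof.
apply/seteqP; split; apply: smallest_sub; try exact: smallest_sigma_algebra.
- move=> _ [i [a ->]]; apply: sub_sigma_algebra; exists [:: (i, a)] => //.
  by rewrite cylinder_cons cylinder_nil setIT.
- by move=> _ [s _ <-]; exact: measurable_cylinder.
Qed.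

Lemma eq_law_cylinder d d' (T : measurableType d) (T' : measurableType d')
    (P : probability T R) (P' : probability T' R)
    (f : T -> real_family R I) (f' : T' -> real_family R I) :
  measurable_fun setT f -> measurable_fun setT f' ->
  (forall s, P (f @^-1` cylinder s) = P' (f' @^-1` cylinder s)) ->
  eq_law P P' f f'.
Proof.
move=> mf mf' ff'; apply: (eq_law_dynkin measurable_cylinders) => //.
- by move=> _ _ [s _ <-] [t _ <-]; rewrite cylinder_cat; exists (s ++ t).
- by move=> _ [s _ <-]; exact: ff'.
Qed.

End families.

Lemma measurable_preimage d d' (T : measurableType d) (S : measurableType d')
    (f : T -> S) E :
  measurable_fun setT f -> measurable E -> measurable (f @^-1` E).
Proof. by move=> mf mE; rewrite -[X in measurable X]setTI; exact: mf. Qed.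

Lemma measurable_fun_index d d' (T : measurableType d) (S : measurableType d')
    (k : T -> nat) (h : nat -> T -> S) :
  (forall n, measurable (k @^-1` [set n])) ->
  (forall n, measurable_fun setT (h n)) ->
  measurable_fun setT (fun w => h (k w) w).
Proof.
move=> mk mh _ E mE; rewrite setTI.
have -> : (fun w => h (k w) w) @^-1` E =
    \bigcup_n (k @^-1` [set n] `&` (h n) @^-1` E).
  apply/seteqP; split => [w Ew|w [n _ [/= <-]]//].
  by exists (k w).
by apply: bigcup_measurable => n _; apply: measurableI => //;
  exact: measurable_preimage.
Qed.

Lemma near_invS_lt (R : realType) (e : R) :
  0 < e -> \forall n \near \oo, n.+1%:R^-1 < e.
Proof. by move=> e0; exact: (near_infty_natSinv_lt (PosNum e0)). Qed.

Section laws.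
Context (R : realType).

Lemma measure_index_partition d (T : measurableType d) (P : probability T R)
    (k : T -> nat) A :
  (forall n, measurable (k @^-1` [set n])) -> measurable A ->
  P A = (\sum_(0 <= n <oo) P (A `&` k @^-1` [set n]))%E.
Proof.
move=> mk mA.
have {1}-> : A = \bigcup_n (A `&` k @^-1` [set n]).
  by apply/seteqP; split => [w Aw|w [n _ []]//]; exists (k w).
rewrite measure_semi_bigcup//.
- by move=> n; exact: measurableI.
- by move=> i j _ _ [w [[_ /= <-] [_ /= <-]]].
- by apply: bigcup_measurable => n _; exact: measurableI.
Qed.

Lemma eq_law_comp d d' (T : measurableType d) (T' : measurableType d')
    (P : probability T R) (P' : probability T' R)
    dS (S : measurableType dS) dS' (S' : measurableType dS')
    (f : T -> S) (f' : T' -> S) (g : S -> S') :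
  measurable_fun setT g -> eq_law P P' f f' ->
  eq_law P P' (g \o f) (g \o f').
Proof.
move=> mg ff' E mE.
exact: (ff' (g @^-1` E) (measurable_preimage mg mE)).
Qed.

(* A transformation may be chosen at random without changing the law if each
   Phi n preserves the law of f, as long as the choice k is not affected by the
   transformation which it selects: {k (Phi n f) = n} and {k f = n} coincide. *)
Lemma eq_law_index d (T : measurableType d) (P : probability T R)
    dS (S : measurableType dS) (f : T -> S) (k : S -> nat)
    (Phi : nat -> S -> S) :
  measurable_fun setT f ->
  (forall n, measurable (k @^-1` [set n])) ->
  (forall n, measurable_fun setT (Phi n)) ->
  (forall n p, k (Phi n p) = n <-> k p = n) ->
  (forall n, eq_law P P (Phi n \o f) f) ->
  eq_law P P (fun w => Phi (k (f w)) (f w)) f.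
Proof.
move=> mf mk mPhi kPhi Phif E mE.
have mkf n : measurable ((k \o f) @^-1` [set n]).
  exact: (measurable_preimage (E := k @^-1` [set n]) mf (mk n)).
have mPf : measurable_fun setT (fun w => Phi (k (f w)) (f w)).
  apply: (@measurable_fun_index _ _ _ _ (k \o f) (fun n => Phi n \o f)) => //.
  by move=> n; exact: measurableT_comp.
rewrite (measure_index_partition P mkf); last exact: measurable_preimage.
rewrite (measure_index_partition P mkf); last exact: measurable_preimage.
apply: eq_eseriesr => n _.
have mEk : measurable (E `&` k @^-1` [set n]) by exact: measurableI.
transitivity (P ((Phi n \o f) @^-1` (E `&` k @^-1` [set n]))).
  congr (P _); apply/seteqP; split => w /= [].
    by move=> + kn; rewrite kn => Ew; split => //; exact/kPhi.
  by move=> Ew /kPhi kn; rewrite kn.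
exact: Phif.
Qed.

Lemma probability_setI1 d (T : measurableType d) (P : probability T R) A G :
  measurable A -> measurable G -> P G = 1%E -> P (A `&` G) = P A.
Proof.
move=> mA mG PG; apply/eqP; rewrite eq_le; apply/andP; split.
  by apply: le_measure; rewrite ?inE//; exact: measurableI.
have PG0 : P (~` G) = 0%E by rewrite probability_setC// PG subee.
rewrite -[leRHS]adde0 -PG0.
have {1}-> : A = (A `&` G) `|` (A `&` ~` G) by rewrite -setIUr setUv setIT.
apply: (le_trans (measureU2 _ _ _)).
- exact: measurableI.
- by apply: measurableI => //; exact: measurableC.
apply: leeD2l; apply: le_measure; rewrite ?inE//.
- by apply: measurableI => //; exact: measurableC.
- exact: measurableC.
Qed.

Let shift I (s : seq (I * R)) (e : R) := [seq (q.1, q.2 + e) | q <- s].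

(* Fatou's lemma for the open set {Z > a + e} and for the closed set {W >= a + e},
   the latter contained in {W > a}. *)
Let cylinder_lim_le d (T : measurableType d) (P : probability T R) I
    (Z W : T -> real_family R I) (Zn Wn : nat -> T -> real_family R I) (G : set T)
    (s : seq (I * R)) :
  measurable_fun setT Z -> measurable_fun setT W ->
  (forall n, measurable_fun setT (Zn n)) ->
  (forall n, measurable_fun setT (Wn n)) ->
  measurable G -> P G = 1%E ->
  (forall w i, G w -> Zn n w i @[n --> \oo] --> Z w i) ->
  (forall w i, G w -> Wn n w i @[n --> \oo] --> W w i) ->
  (forall n, eq_law P P (Zn n) (Wn n)) ->
  forall e, 0 < e ->
  (P (Z @^-1` cylinder (shift s e)) <= P (W @^-1` cylinder s))%E.
Proof.
move=> mZ mW mZn mWn mG PG cZ cW ZW e e0.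
pose E n := Zn n @^-1` cylinder (shift s e).
pose F n := Wn n @^-1` cylinder (shift s e).
have mE n : measurable (E n).
  by apply: measurable_preimage => //; exact: measurable_cylinder.
have mF n : measurable (F n).
  by apply: measurable_preimage => //; exact: measurable_cylinder.
(* [\bigcup_M L M] is the liminf of the [E n] and [\bigcap_M U M] the limsup of the [F n]. [L M] and
   [U M'] are compared through the index [maxn M M'], at which [Zn] and [Wn] have the same law. *)
pose L M := \bigcap_(n in [set n | (M <= n)%N]) E n.
pose U M := \bigcup_(n in [set n | (M <= n)%N]) F n.
have mL M : measurable (L M) by apply: bigcap_measurableType.
have mU M : measurable (U M) by apply: bigcup_measurable.
have mLL : measurable (\bigcup_M L M) by exact: bigcupT_measurable.
have mUU : measurable (\bigcap_M U M) by exact: bigcapT_measurable.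
have LU M M' : (P (L M) <= P (U M'))%E.
  apply: (@le_trans _ _ (P (E (maxn M M')))).
    apply: le_measure; rewrite ?inE// => w; apply; exact: leq_maxl.
  have -> : P (E (maxn M M')) = P (F (maxn M M')).
    by apply: ZW; exact: measurable_cylinder.
  by apply: le_measure; rewrite ?inE// => w Fw; exists (maxn M M') => //=;
    exact: leq_maxr.
have cL : P \o L @ \oo --> P (\bigcup_M L M).
  apply: nondecreasing_cvg_mu => //.
  move=> m n mn; apply/subsetPset => w Lw k /= nk; apply: Lw => /=.
  exact: leq_trans nk.
have cU : P \o U @ \oo --> P (\bigcap_M U M).
  apply: nonincreasing_cvg_mu => //.
    by rewrite (le_lt_trans (probability_le1 _ _))// ltry.
  move=> m n mn; apply/subsetPset => w [k /= nk Fw]; exists k => //=.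
  exact: leq_trans nk.
have LLUU : (P (\bigcup_M L M) <= P (\bigcap_M U M))%E.
  rewrite -(cvg_lim _ cU)//; apply: lime_ge.
    by apply/cvg_ex; eexists; exact: cU.
  apply: nearW => M'; rewrite -(cvg_lim _ cL)//; apply: lime_le.
    by apply/cvg_ex; eexists; exact: cL.
  by apply: nearW => M; exact: LU.
rewrite -(probability_setI1 _ mG PG); last first.
  by apply: measurable_preimage => //; exact: measurable_cylinder.
apply: (@le_trans _ _ (P (\bigcup_M L M))).
  apply: le_measure; rewrite ?inE//.
    apply: measurableI => //; apply: measurable_preimage => //.
    exact: measurable_cylinder.
  move=> w [Zw Gw].
  have : \forall n \near \oo, cylinder (shift s e) (Zn n w).
    move: Zw; rewrite /cylinder/=.
    elim: s {E F mE mF L U mL mU mLL mUU LU cL cU LLUU}.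
      by move=> _; exact: nearW.
    move=> q s IH /= /andP[qZ /IH sZ].
    near=> n; apply/andP; split; last by near: n.
    by near: n; apply: cvgr_gt (cZ _ _ Gw) _ _.
  by move=> [M _ ME]; exists M => // n /= Mn; exact: ME.
apply: (le_trans LLUU).
rewrite -(probability_setI1 mUU mG PG).
apply: le_measure; rewrite ?inE//.
- exact: measurableI.
- by apply: measurable_preimage => //; exact: measurable_cylinder.
move=> w [Uw Gw].
have {Uw} : forall M, exists2 n, (M <= n)%N & cylinder (shift s e) (Wn n w).
  by move=> M; have [n /= Mn Fw] := Uw M Logic.I; exists n.
rewrite /cylinder/=; elim: s {E F mE mF L U mL mU mLL mUU LU cL cU LLUU} => //=.
move=> q s IH Uw; apply/andP; split; last first.
  by apply: IH => M; have [n Mn /andP[_ sW]] := Uw M; exists n.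
rewrite ltNge; apply/negP => Wq.
have : \forall n \near \oo, Wn n w q.1 < q.2 + e.
  by apply: cvgr_lt (cW _ _ Gw) _ _; rewrite (le_lt_trans Wq)// ltrDl.
move=> [M _ MW]; have [n Mn /andP[+ _]] := Uw M.
by rewrite ltNge ltW//; exact: MW.
Unshelve. all: by end_near. Qed.

(** Since its inequalities are strict, a cylinder is the increasing union of the cylinders shifted
    by 1/(n+1); continuity from below removes the shift. *)
Let cylinder_lim_le0 d (T : measurableType d) (P : probability T R) I
    (Z W : T -> real_family R I) (s : seq (I * R)) :
  measurable_fun setT Z -> measurable_fun setT W ->
  (forall e, 0 < e ->
    (P (Z @^-1` cylinder (shift s e)) <= P (W @^-1` cylinder s))%E) ->
  (P (Z @^-1` cylinder s) <= P (W @^-1` cylinder s))%E.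
Proof.
move=> mZ mW ZW.
have cZ : P \o (fun n => Z @^-1` cylinder (shift s n.+1%:R^-1)) @ \oo -->
    P (\bigcup_n Z @^-1` cylinder (shift s n.+1%:R^-1)).
  apply: nondecreasing_cvg_mu => //.
  - by move=> n; apply: measurable_preimage => //; exact: measurable_cylinder.
  - apply: bigcupT_measurable => n; apply: measurable_preimage => //.
    exact: measurable_cylinder.
  - move=> m n mn; apply/subsetPset => w; rewrite /cylinder/=.
    elim: s {ZW} => //= q s IH /andP[qZ /IH ->]; rewrite andbT.
    by apply: le_lt_trans qZ; rewrite lerD2l lef_pV2 ?posrE// ler_nat.
have -> : Z @^-1` cylinder s =
    \bigcup_n Z @^-1` cylinder (shift s n.+1%:R^-1).
  apply/seteqP; split => w; last first.
    move=> [n _]; rewrite /cylinder/=.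
    elim: s {ZW cZ} => //= q s IH /andP[qZ /IH ->]; rewrite andbT.
    by apply: lt_trans qZ; rewrite ltrDl.
  move=> Zs; suff : \forall n \near \oo, cylinder (shift s n.+1%:R^-1) (Z w).
    by move=> [n _ /(_ n (leqnn n)) Zn]; exists n.
  move: Zs; rewrite /cylinder/=.
  elim: s {ZW cZ} => //= [_|q s IH]; first exact: nearW.
  move=> /andP[qZ /IH sZ].
  near=> n; apply/andP; split; last by near: n.
  rewrite -ltrBrDl; near: n.
  by apply: near_invS_lt; rewrite subr_gt0.
rewrite -(cvg_lim _ cZ)//; apply: lime_le.
  by apply/cvg_ex; eexists; exact: cZ.
by apply: nearW => n; exact: ZW.
Unshelve. all: by end_near. Qed.

Lemma eq_law_lim d (T : measurableType d) (P : probability T R) I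
    (Z W : T -> real_family R I) (Zn Wn : nat -> T -> real_family R I) (G : set T) :
  measurable_fun setT Z -> measurable_fun setT W ->
  (forall n, measurable_fun setT (Zn n)) ->
  (forall n, measurable_fun setT (Wn n)) ->
  measurable G -> P G = 1%E ->
  (forall w i, G w -> Zn n w i @[n --> \oo] --> Z w i) ->
  (forall w i, G w -> Wn n w i @[n --> \oo] --> W w i) ->
  (forall n, eq_law P P (Zn n) (Wn n)) ->
  eq_law P P Z W.
Proof.
move=> mZ mW mZn mWn mG PG cZ cW ZW.
apply: eq_law_cylinder => // s; apply/eqP; rewrite eq_le; apply/andP; split.
  apply: cylinder_lim_le0 => // e.
  exact: (cylinder_lim_le s mZ mW mZn mWn mG).
apply: cylinder_lim_le0 => // e.
apply: (cylinder_lim_le s mW mZ mWn mZn mG) => //.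
by move=> n E mE; rewrite ZW.
Qed.

End laws.

(** * Brownian motion flipped at a fixed time *)

Section brownian_motion_mirror.
Context (R : realType).

(** The map [b] sorts the coordinates into independent blocks. The probability of a cylinder is the
    product of those of its blocks, so the laws need only be compared within one block. *)
Lemma eq_law_blocks d (T : measurableType d) (P : probability T R)
    (I : finType) J (b : J -> I) (G : I -> set_system T)
    (f f' : T -> real_family R J) :
  mutually_independent P G ->
  measurable_fun setT f -> measurable_fun setT f' ->
  (forall i s, all (fun q => b q.1 == i) s -> G i (f @^-1` cylinder s)) ->
  (forall i s, all (fun q => b q.1 == i) s -> G i (f' @^-1` cylinder s)) ->
  (forall i s, all (fun q => b q.1 == i) s ->
     P (f @^-1` cylinder s) = P (f' @^-1` cylinder s)) ->
  eq_law P P f f'.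
Proof.
move=> indG mf mf' Gf Gf' ff'; apply: eq_law_cylinder => // s.
pose r i := [seq q <- s | b q.1 == i].
have all_r i : all (fun q => b q.1 == i) (r i) by exact: filter_all.
have split_s (g : T -> real_family R J) : g @^-1` cylinder s =
    \bigcap_(i in [set` [set: I]%SET]) (g @^-1` cylinder (r i)).
  apply/seteqP; split => w; rewrite /cylinder/=.
    by move=> gs i _ /=; rewrite all_filter; apply: sub_all gs => q /= ->;
      rewrite implybT.
  rewrite /r; elim: s {r all_r} => //= q s IH gr; apply/andP; split.
    have := gr (b q.1); rewrite /= eqxx /= inE => /(_ isT) /andP[]//.
  apply: IH => i _ /=; have := gr i; rewrite /= inE => /(_ isT).
  by case: ifP => //= _ /andP[].
rewrite !split_s !indG; first by apply: eq_bigr => i _; exact: ff'.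
  by move=> i _; exact: Gf'.
by move=> i _; exact: Gf.
Qed.

(* normal_prob 0 0 is the uniform law on [0, 1], which is not symmetric. *)
Lemma normal_probN (s : R) (A : set R) : s != 0 -> measurable A ->
  normal_prob 0 s (-%R @^-1` A) = normal_prob 0 s A.
Proof.
move=> s0 mA; rewrite /normal_prob.
have mN : measurable_fun setT (-%R : R -> measurableTypeR R).
  exact: oppr_measurable.
have pN x : normal_pdf 0 s (- x) = normal_pdf 0 s x.
  by rewrite normal_pdfE// /normal_fun !subr0 sqrrN.
have mp : measurable_fun [set: R] (fun x => (normal_pdf 0 s x)%:E).
  by apply/measurable_EFinP; exact: measurable_normal_pdf.
transitivity (\int[pushforward lebesgue_measure
    (-%R : R -> measurableTypeR R)]_(x in A) (normal_pdf 0 s x)%:E)%E.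
  rewrite ge0_integral_pushforward//=; last 2 first.
    exact: measurable_funS mp.
    by move=> x _; rewrite lee_fin normal_pdf_ge0.
  by apply: eq_integral => x _ /=; rewrite pN.
by apply: eq_measure_integral => B mB BA; exact: lebesgue_measureN.
Qed.

(** The second branch is [c q - (c t - c q)]: the increment after [q] changes sign. *)
Definition mirror (q : R) (c : R -> R) (t : R) : R :=
  if t <= q then c t else c q *+ 2 - c t.

Lemma measurable_ray_seq (s : seq R) :
  measurable [set x : R | all (fun a => a < x) s].
Proof.
elim: s => [|a s IH].
  by rewrite (_ : [set _ | _] = setT)//; apply/seteqP; split.
rewrite (_ : [set _ | _] = `]a, +oo[ `&` [set x | all (fun a => a < x) s]).
  by apply: measurableI => //; exact: measurable_itv.
by apply/seteqP; split => x /=; rewrite in_itv/= andbT => /andP.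
Qed.

Lemma cylinder_single (J : eqType) (i : J) (s : seq (J * R)) :
  all (fun q => q.1 == i) s ->
  cylinder s =
  [set p | [set x : R | all (fun a => a < x) [seq q.2 | q <- s]] (p i)].
Proof.
move=> si; apply/seteqP; split => p; rewrite /cylinder/= all_map;
  elim: s si => //= q s IH /andP[/eqP qi si] /andP[h hs];
  by apply/andP; split; [rewrite (qi, esym qi)|exact: IH].
Qed.

Lemma increments_sign_change d (T : measurableType d) (P : probability T R)
    b0 (B : R -> T -> R) (k j : nat) (u : nat -> R) :
  brownian_motion P b0 B ->
  0 <= u 0%N -> (forall i, (i < k)%N -> u i <= u i.+1) ->
  let D i w := B (u i.+1) w - B (u i) w in
  eq_law P P (fun w => (fun i : 'I_k => D i w) : real_family R 'I_k)
    (fun w => (fun i : 'I_k => if (i < j)%N then D i w else - D i w)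
      : real_family R 'I_k).
Proof.
move=> [pB cB B0 nB iB] u0 uS D.
have u_ge0 i : (i <= k)%N -> 0 <= u i.
  by elim: i => // i IH ik; exact: (le_trans (IH (ltnW ik)) (uS _ ik)).
have mBt t : 0 <= t -> measurable_fun setT (B t).
  by move=> t0 _ A mA; rewrite setTI; exact: pB.
have mD (i : 'I_k) : measurable_fun setT (D i).
  by apply: measurable_funB; apply: mBt; apply: u_ge0 => //; exact: ltnW.
have DN (i : 'I_k) (A : set R) : measurable A ->
    P (D i @^-1` (-%R @^-1` A)) = P (D i @^-1` A).
  move=> mA; have mNA : measurable (-%R @^-1` A : set R).
    by rewrite -[X in measurable X]setTI; exact: oppr_measurable.
  (* The normal law of an increment is only available for distinct times; for equal times the
     increment is 0, its own opposite. *)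
  have [uE|uN] := eqVneq (u i) (u i.+1).
    congr (P _); apply/seteqP; split => w /=;
      by rewrite /D uE subrr oppr0.
  have uL : u i < u i.+1 by rewrite lt_neqAle uN uS.
  have ui : 0 <= u i by apply: u_ge0; exact: ltnW.
  rewrite [LHS](nB _ _ _ ui uL mNA) [RHS](nB _ _ _ ui uL mA).
  by apply: normal_probN => //; rewrite gt_eqF// sqrtr_gt0 subr_gt0.
apply: (eq_law_blocks (b := id) (iB k u u0 uS)).
- by apply: measurable_family => i; exact: mD.
- apply: measurable_family => i; case: (ltnP i j) => _; first exact: mD.
  exact: measurable_funN.
- move=> i s si; rewrite (cylinder_single (i := i) si).
  eexists; last by rewrite setTI.
  exact: measurable_ray_seq.
- move=> i s si; rewrite (cylinder_single (i := i) si).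
  set A := [set x : R | _].
  have mA : measurable A by exact: measurable_ray_seq.
  exists (if (i < j)%N then A else -%R @^-1` A); last first.
    by rewrite setTI; apply/seteqP; split => w /=; case: ifP.
  case: ifP => // _.
  by rewrite -[X in measurable X]setTI; exact: oppr_measurable.
- move=> i s si; rewrite (cylinder_single (i := i) si).
  set A := [set x : R | _].
  have mA : measurable A by exact: measurable_ray_seq.
  rewrite -[LHS](_ : P (D i @^-1` A) = _)//.
  case: (ltnP i j) => ij.
    by congr (P _); apply/seteqP; split => w /=; rewrite ij.
  rewrite -(DN _ _ mA).
  by congr (P _); apply/seteqP; split => w /=; rewrite ltnNge ij.
Qed.

Lemma mirror_le q c t : t <= q -> mirror q c t = c t.
Proof. by rewrite /mirror => ->. Qed.

Lemma mirror_ge q c t : q <= t -> mirror q c t = c q *+ 2 - c t.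
Proof.
rewrite /mirror le_eqVlt => /predU1P[->|]; last by rewrite ltNge => /negbTE->.
by rewrite lexx mulr2n addrK.
Qed.

(** A cylinder involves finitely many times, where the path is a function of its start and of
    finitely many increments; the mirror changes the sign of those after [q]. The index [|t|] makes
    every coordinate measurable. *)
Lemma brownian_motion_mirror d (T : measurableType d) (P : probability T R)
    b0 (B : R -> T -> R) (q : R) :
  brownian_motion P b0 B -> 0 <= q ->
  eq_law P P (fun w => (fun t : R => mirror q (B^~ w) `|t|) : real_family R R)
    (fun w => (fun t : R => B `|t| w) : real_family R R).
Proof.
move=> bmB q0; have [pB cB B0 nB iB] := bmB.
have mBt t : 0 <= t -> measurable_fun setT (B t).
  by move=> t0 _ A mA; rewrite setTI; exact: pB.
have mB : measurable_fun setT
    (fun w => (fun t : R => B `|t| w) : real_family R R).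
  by apply: measurable_family => t; exact: mBt.
have mB' : measurable_fun setT
    (fun w => (fun t : R => mirror q (B^~ w) `|t|) : real_family R R).
  apply: measurable_family => t; rewrite /mirror; case: (leP `|t| q) => _.
    exact: mBt.
  apply: measurable_funB; last exact: mBt.
  by apply: measurable_funD; exact: mBt.
apply: eq_law_cylinder => // s.
(* L subdivides time so that each increment lies on one side of q. *)
pose L := sort <=%R (0 :: q :: [seq `|p.1| | p <- s]).
pose k := (size L).-1.
pose u i := nth 0 L i.
pose j := index q L.
have sL : size L = k.+1 by rewrite /k size_sort.
have sortL : sorted <=%R L by apply: sort_sorted; exact: le_total.
have L_ge0 : all (fun x => 0 <= x) L.
  rewrite all_sort /= lexx q0/= all_map; apply/allP => p _ /=; exact: normr_ge0.
have uM i i' : (i <= i' <= k)%N -> u i <= u i'.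
  move=> /andP[ii' i'k].
  apply: (sorted_leq_nth le_trans le_refl _ sortL) => //.
  - by rewrite inE sL ltnS (leq_trans ii').
  - by rewrite inE sL ltnS.
have qL : q \in L by rewrite mem_sort !inE eqxx orbT.
have jk : (j <= k)%N by rewrite -ltnS -sL index_mem.
have uj : u j = q by exact: nth_index.
have u0 : u 0%N = 0.
  have zL : 0 \in L by rewrite mem_sort inE eqxx.
  apply/eqP; rewrite eq_le; apply/andP; split.
    rewrite -[X in _ <= X](nth_index 0 zL); apply: uM.
    by rewrite leq0n -ltnS -sL index_mem.
  by move/all_nthP: L_ge0 => -> //; rewrite sL.
pose D i w := B (u i.+1) w - B (u i) w.
have DD' : eq_law P P (fun w => (fun i : 'I_k => D i w) : real_family R 'I_k)
    (fun w => (fun i : 'I_k => if (i < j)%N then D i w else - D i w)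
      : real_family R 'I_k).
  apply: (increments_sign_change j bmB); first by rewrite u0.
  by move=> i ik; apply: uM; rewrite leqnSn.
(* g rebuilds the values on L from the increments, given B 0 = b0. *)
pose g (e : real_family R 'I_k) : real_family R R :=
  fun t => b0 + \sum_(i < k) (if (i < index `|t|%R L)%N then e i else 0).
have mg : measurable_fun setT g.
  apply: measurable_family => t; apply: measurable_funD => //.
  apply: measurable_sum => i.
  by case: (ltnP i (index `|t|%R L)) => // _; exact: measurable_coord.
(* The sum telescopes, starting from [F 0 = b0]; this is why 0 was put into [L]. *)
have gD (F : nat -> R) (e : real_family R 'I_k) (t : R) :
    (forall i : 'I_k, e i = F i.+1 - F i) -> `|t| \in L -> F 0%N = b0 ->
    g e t = F (index `|t|%R L).
  move=> eF tL F0; rewrite /g -big_mkcond/=.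
  have ik : (index `|t|%R L <= k)%N by rewrite -ltnS -sL index_mem.
  under eq_bigr do rewrite eF.
  rewrite -(big_ord_widen k (fun i => F i.+1 - F i) ik).
  by rewrite -(big_mkord predT (fun i => F i.+1 - F i)) telescope_sumr// F0 subrKC.
have cylE (e1 e2 : real_family R R) :
    (forall t : R, `|t| \in L -> e1 t = e2 t) -> cylinder s e1 = cylinder s e2.
  move=> e12; rewrite /cylinder/=; congr is_true.
  apply: eq_in_all => p ps; rewrite e12// mem_sort !inE.
  by rewrite (map_f (fun p => `|p.1|) ps) !orbT.
pose G := [set w | B 0 w = b0].
have mG : measurable G.
  rewrite [G](_ : _ = B 0 @^-1` [set b0])//.
  exact: measurable_preimage (mBt _ (lexx _)) (measurable_set1 _).
(* The path starts at [b0] only almost surely, so both events are first intersected with [G]. *)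
have mD (h : T -> real_family R R) (e : T -> real_family R 'I_k) :
    measurable_fun setT h -> measurable_fun setT e ->
    (forall w, G w -> forall t : R, `|t| \in L -> h w t = g (e w) t) ->
    P (h @^-1` cylinder s) = P (e @^-1` (g @^-1` cylinder s)).
  move=> mh me he.
  have mc := measurable_cylinder s.
  rewrite -(probability_setI1 _ mG B0); last exact: measurable_preimage.
  rewrite -[RHS](probability_setI1 _ mG B0); last first.
    by apply: measurable_preimage => //; exact: measurable_preimage.
  congr (P _); apply/seteqP; split => w [cw Gw]; split => //.
    by change (cylinder s (g (e w))); rewrite -(cylE _ _ (he w Gw)).
  by change (cylinder s (h w)); rewrite (cylE _ _ (he w Gw)).
have mDt (i : 'I_k) : measurable_fun setT (D i).
  apply: measurable_funB; apply: mBt; rewrite -u0; apply: uM => //=.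
  exact: ltnW.
rewrite (mD _ (fun w i => if (i < j)%N then D i w else - D i w)) //; first last.
- move=> w Gw t tL.
  rewrite (gD (fun i => mirror q (B^~ w) (u i)))//.
  + by rewrite /u nth_index.
  + move=> i; case: (ltnP i j) => ij.
      have u1q : u i.+1 <= q by rewrite -uj; apply: uM; rewrite ij.
      have uq : u i <= q by rewrite -uj; apply: uM; rewrite (ltnW ij).
      by rewrite !mirror_le.
    have qu : q <= u i by rewrite -uj; apply: uM; rewrite ij ltnW.
    have qu1 : q <= u i.+1.
      by rewrite -uj; apply: uM; rewrite (leq_trans ij)//=.
    by rewrite !mirror_ge// /D; lra.
  + by rewrite u0 mirror_le.
- apply: measurable_family => i; case: (ltnP i j) => // _.
  exact: measurable_funN.
rewrite (mD _ (fun w i => D i w)) //; first last.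
- move=> w Gw t tL.
  rewrite (gD (fun i => B (u i) w))//.
  + by rewrite /u nth_index.
  + by rewrite u0.
- exact: measurable_family.
have mgc : measurable (g @^-1` cylinder s).
  by apply: measurable_preimage => //; exact: measurable_cylinder.
by rewrite -(DD' _ mgc).
Qed.

End brownian_motion_mirror.

(** * Rounding down to the grid of multiples of 1/(n+1) *)

Section grid.
Context {R : realType}.

(** For [x < 0] the truncation is 0, so the rounded value is always an admissible time. *)
Definition grid (n : nat) (x : R) : R := (Num.truncn (n.+1%:R * x))%:R / n.+1%:R.

Lemma grid_ge0 n x : 0 <= grid n x.
Proof. by rewrite /grid divr_ge0. Qed.

Lemma grid_le n x y : x <= y -> grid n x <= grid n y.
Proof.
move=> xy; rewrite /grid ler_pM2r ?invr_gt0// ler_nat; apply: le_truncn.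
by rewrite ler_pM2l.
Qed.

Lemma grid_bounds n x : 0 <= x -> grid n x <= x < grid n x + n.+1%:R^-1.
Proof.
move=> x0; have nx0 : 0 <= n.+1%:R * x by exact: mulr_ge0.
have /andP[h1 h2] := truncn_itv nx0.
rewrite /grid ler_pdivrMr// [x * _]mulrC h1/=.
by rewrite -[X in _ + X]mul1r -mulrDl ltr_pdivlMr// [x * _]mulrC natr1.
Qed.

Lemma grid_cvg x : 0 <= x -> grid n x @[n --> \oo] --> x.
Proof.
move=> x0; apply: (@squeeze_cvgr _ _ _ _ (fun n => x - n.+1%:R^-1) (cst x)).
- apply: nearW => n; have /andP[h1 h2] := grid_bounds n x0.
  by rewrite h1 andbT lerBlDr ltW.
- rewrite -[X in _ --> X]subr0; apply: cvgB; first exact: cvg_cst.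
  exact: cvg_harmonic.
- exact: cvg_cst.
Qed.

Lemma measurable_truncn (k : nat) :
  measurable [set x : R | Num.truncn x = k].
Proof.
(* The value 0 is also taken at every negative number, hence the unbounded interval. *)
rewrite (_ : [set _ | _] = if k == 0%N then `]-oo, 1[ else `[k%:R, k.+1%:R[)%classic.
  by case: ifP => _; exact: measurable_itv.
apply/seteqP; split => x /=.
  move=> <-; have [x0|x0] := leP 0 x.
    have /andP[h1 h2] := truncn_itv x0.
    by case: eqP => [e|_] /=; rewrite in_itv/= ?h1//; move: h2; rewrite e.
  have -> : Num.truncn x = 0%N.
    by apply: contra_ltP x0 => /eqP; rewrite -lt0n truncn_gt0 => /(le_trans ler01).
  by rewrite /= in_itv/= (lt_trans x0).
case: eqP => [->|_]; rewrite /= in_itv/=; last exact: truncn_def.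
move=> x1; apply/eqP; rewrite -leqn0 leqNgt truncn_gt0 -ltNge//.
Qed.

(** The rounded random time takes countably many values, so no joint measurability of [h] is
    required. *)
Lemma measurable_fun_grid d d' (T : measurableType d) (S : measurableType d')
    n (x : T -> R) (h : R -> T -> S) :
  measurable_fun setT x ->
  (forall t, 0 <= t -> measurable_fun setT (h t)) ->
  measurable_fun setT (fun w => h (grid n (x w)) w).
Proof.
move=> mx mh.
apply: (measurable_fun_index (k := fun w => Num.truncn (n.+1%:R * x w))
  (h := fun k => h (k%:R / n.+1%:R))) => k.
  have mnx : measurable_fun setT (fun w => n.+1%:R * x w).
    exact: measurable_funM.
  exact: (measurable_preimage mnx (measurable_truncn k)).
by apply: mh; rewrite divr_ge0.
Qed.

Lemma within_cvg_seq (c : R -> R) (u : nat -> R) (l : R) :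
  {within `[0, +oo[, continuous c} -> (forall n, 0 <= u n) -> 0 <= l ->
  u n @[n --> \oo] --> l -> c (u n) @[n --> \oo] --> c l.
Proof.
move=> cc u0 l0 ul.
have /subspace_continuousP/(_ l) := cc.
rewrite /= in_itv/= l0 => /(_ isT) cl.
apply: cvg_trans cl => A /= cA.
have ucA : \forall n \near \oo, u n \in `[0, +oo[ -> A (c (u n)) := ul _ cA.
by apply: filterS ucA => n; apply; rewrite in_itv/= u0.
Qed.

End grid.

(** * Processes as families indexed by time and space coordinate *)

Section processes_and_families.
Context {R : realType} {d : measure_display} {T : measurableType d}.

Lemma sigma_process_sigma_algebra (S : Type) (M : set_system S)
    (X : R -> T -> S) :
  sigma_algebra setT (sigma_process M X).
Proof. by apply: sigma_algebra_preimage; exact: smallest_sigma_algebra. Qed.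

Lemma sigma_process_time (S : Type) (M : set_system S)
    (X : R -> T -> S) (t : R) (A : set S) :
  0 <= t -> M A -> sigma_process M X (X t @^-1` A).
Proof.
move=> t0 MA; exists [set p | A (p t)]; last by rewrite setTI.
by apply: sub_sigma_algebra; exists t, A.
Qed.

(* The time is taken in absolute value: processes are only measurable at times
   t >= 0. *)
Definition coords m (X : R -> T -> 'rV[R]_m) (w : T) :
    real_family R (R * 'I_m) :=
  fun ti => X `|ti.1| w ord0 ti.2.

Definition mirror_coord m (q : R) (p : real_family R (R * 'I_m.+1)) :
    real_family R (R * 'I_m.+1) :=
  fun ti => if ti.2 == ord0 then mirror q (fun t => p (t, ord0)) `|ti.1|
            else p ti.

Lemma measurable_mirror_coord m q :
  measurable_fun setT (@mirror_coord m q).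
Proof.
apply: measurable_family => -[t i] /=; rewrite /mirror_coord /mirror /=.
case: (i == ord0); last exact: measurable_coord.
case: (leP `|t| q) => _; first exact: measurable_coord.
apply: measurable_funB; last exact: measurable_coord.
by apply: measurable_funD; exact: measurable_coord.
Qed.

Lemma measurable_coords m (X : R -> T -> 'rV[R]_m) :
  (forall t i, 0 <= t -> measurable_fun setT (fun w => X t w ord0 i)) ->
  measurable_fun setT (coords X).
Proof. by move=> mX; apply: measurable_family => -[t i]; exact: mX. Qed.

Lemma cylinder_coord m (i : 'I_m) (s : seq ((R * 'I_m) * R))
    (p : real_family R (R * 'I_m)) :
  all (fun q => q.1.2 == i) s ->
  cylinder s p =
  cylinder [seq (q.1.1, q.2) | q <- s] (fun t => p (t, i) : R).
Proof.
rewrite /cylinder/= all_map => si; congr is_true.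
by apply: eq_in_all => -[[t j] a] /(allP si) /= /eqP ->.
Qed.

End processes_and_families.
Arguments mirror_coord {R m}.
Arguments measurable_mirror_coord {R m}.

Section mirror_brownian_motion_rV.
Context {R : realType} {d : measure_display} {T : measurableType d}.

(** The blocks are the space coordinates, which are independent. Only the block of the first one
    changes, and there the one-dimensional result applies. *)
Lemma brownian_motion_rV_mirror (P : probability T R) m b
    (beta : R -> T -> 'rV[R]_m.+1) q :
  brownian_motion_rV P b beta -> 0 <= q ->
  eq_law P P (mirror_coord q \o coords beta) (coords beta).
Proof.
move=> [bmB indB] q0.
pose bt i t w := beta t w ord0 i.
pose G i := sigma_process measurable (bt i).
(* [G i] is already a sigma-algebra, so membership in it can be proved as measurability on the space
   equipped with [G i]. *)
have GE i : (G i).-sigma.-measurable = G i.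
  exact/sigma_algebra_id/sigma_process_sigma_algebra.
have mG i t : 0 <= t ->
    measurable_fun [set: g_sigma_algebraType (G i)] (bt i t).
  move=> t0 _ A mA; rewrite setTI GE; exact: sigma_process_time.
have mb i t : 0 <= t -> measurable_fun setT (bt i t).
  by move=> t0 _ A mA; rewrite setTI; have [pB _ _ _ _] := bmB i; exact: pB.
have mcb : measurable_fun setT (coords beta).
  by apply: measurable_coords => t i; exact: mb.
have mG1 i : measurable_fun [set: g_sigma_algebraType (G i)]
    (fun w => (fun t => bt i `|t| w) : real_family R R).
  by apply: measurable_family => t; exact: mG.
have Gcb i s : all (fun q => q.1.2 == i) s ->
    G i (coords beta @^-1` cylinder s).
  move=> si.
  have := measurable_preimage (mG1 i)
    (measurable_cylinder [seq (q.1.1, q.2) | q <- s]).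
  rewrite GE; congr (G i _); apply/seteqP; split => w;
  by rewrite /= (cylinder_coord _ si).
have mirrorE w : (fun t => (mirror_coord q \o coords beta) w (t, ord0)) =
    (fun t => mirror q (bt ord0 ^~ w) `|t|).
  apply/funext => t; rewrite /= /mirror_coord /= /mirror /coords /=.
  by rewrite normr_id (ger0_norm q0).
have mirrorN i w : i != ord0 ->
    (fun t => (mirror_coord q \o coords beta) w (t, i)) =
    (fun t => coords beta w (t, i)).
  by move=> /negbTE i0; apply/funext => t; rewrite /= /mirror_coord /= i0.
apply: (eq_law_blocks (b := snd) indB) => //.
- by apply: measurableT_comp mcb; exact: measurable_mirror_coord.
- move=> i s si; have [i0|i0] := eqVneq i ord0; last first.
    have := Gcb i s si; congr (G i _); apply/seteqP; split => w;
    by rewrite /= !(cylinder_coord _ si) mirrorN.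
  rewrite {i}i0 in si *.
  have mG2 : measurable_fun [set: g_sigma_algebraType (G ord0)]
      (fun w => (fun t => mirror q (bt ord0 ^~ w) `|t|) : real_family R R).
    apply: measurable_family => t; rewrite /mirror; case: (leP `|t| q) => _.
      exact: mG.
    apply: measurable_funB; last exact: mG.
    by apply: measurable_funD; exact: mG.
  have := measurable_preimage mG2
    (measurable_cylinder [seq (q.1.1, q.2) | q <- s]).
  rewrite GE; congr (G ord0 _); apply/seteqP; split => w;
  by rewrite /= (cylinder_coord _ si) mirrorE.
- move=> i s si; have [i0|i0] := eqVneq i ord0; last first.
    congr (P _); apply/seteqP; split => w;
    by rewrite /= !(cylinder_coord _ si) mirrorN.
  rewrite {i}i0 in si *.
  have := brownian_motion_mirror (bmB ord0) q0
    (measurable_cylinder [seq (q.1.1, q.2) | q <- s]).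
  congr (P _ = P _); apply/seteqP; split => w;
  by rewrite /= (cylinder_coord _ si) ?mirrorE.
Qed.

End mirror_brownian_motion_rV.

(** * The time change *)

(** By independence the probability of a rectangle factors, and rectangles form a generating
    pi-system. *)
Lemma eq_law_pair (R : realType) d (T : measurableType d)
    (P : probability T R) d1 d2 (S1 : measurableType d1)
    (S2 : measurableType d2) (G H : set_system T) (f f' : T -> S1)
    (e : T -> S2) :
  independent2 P G H ->
  measurable_fun setT f -> measurable_fun setT f' -> measurable_fun setT e ->
  (forall E, measurable E -> G (f @^-1` E)) ->
  (forall E, measurable E -> G (f' @^-1` E)) ->
  (forall E, measurable E -> H (e @^-1` E)) ->
  eq_law P P f f' ->
  eq_law P P (fun w => (f w, e w)) (fun w => (f' w, e w)).
Proof.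
move=> indGH mf mf' me Gf Gf' He ff'.
apply: (eq_law_dynkin (measurable_prod_measurableType S1 S2)).
- move=> _ _ [A mA [B mB <-]] [A' mA' [B' mB' <-]].
  rewrite -setXI; exists (A `&` A'); first exact: measurableI.
  by exists (B `&` B') => //; exact: measurableI.
- exact: measurable_fun_pair.
- exact: measurable_fun_pair.
- move=> _ [A mA [B mB <-]].
  transitivity (P (f @^-1` A `&` e @^-1` B)); first by [].
  transitivity (P (f' @^-1` A `&` e @^-1` B)); last by [].
  rewrite !indGH ?ff'//; by [exact: Gf|exact: Gf'|exact: He].
Qed.

Section clock.
Context {R : realType} {d : measure_display} {T : measurableType d}.

(* A continuous path is the limit of its values at times rounded down to a grid,
   hence jointly measurable in (w, s), and Tonelli applies. *)
Lemma measurable_Rintegral_path (c : R -> T -> R) (t : R) :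
  (forall s, 0 <= s -> measurable_fun setT (c s)) ->
  (forall w, {within `[0, +oo[, continuous (c ^~ w)}) ->
  (forall s w, 0 <= c s w) ->
  measurable_fun setT
    (fun w => \int[lebesgue_measure]_(s in `[0, t]) c s w).
Proof.
move=> mc cc c0.
have mJ : measurable_fun [set: T * R] (fun p : T * R => c `|p.2| p.1).
  apply: (@measurable_fun_cvg _ _ _ _ (fun n (p : T * R) => c (grid n `|p.2|) p.1)).
    move=> n; apply: (measurable_fun_grid n (x := fun p : T * R => `|p.2|)
        (h := fun t (p : T * R) => c t p.1)).
      by apply: measurableT_comp => //; exact: measurable_snd.
    by move=> u u0; apply: measurableT_comp (mc u u0) measurable_fst.
  move=> [w u] _ /=; apply: (@within_cvg_seq _ (c ^~ w)) => //.
    by move=> n; exact: grid_ge0.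
  exact: grid_cvg.
(* The integrand is extended by 0 outside [[0, t]]; inside, [|s| = s]. *)
pose F (p : T * R) : \bar R := (\1_`[0, t] p.2 * c `|p.2| p.1)%:E.
have mF : measurable_fun setT F.
  apply/measurable_EFinP; apply: measurable_funM => //.
  apply: measurableT_comp measurable_snd.
  by apply: measurable_indic; exact: measurable_itv.
have F0 p : (0 <= F p)%E.
  by rewrite lee_fin mulr_ge0// indicE.
have := measurable_fun_fubini_tonelli_F (m2 := @lebesgue_measure R) F mF F0.
move=> /(measurableT_comp (fine_measurable measurableT)).
apply: eq_measurable_fun => w _.
rewrite /= /fubini_F /Rintegral; congr fine.
rewrite [RHS]integral_mkcond; apply: eq_integral => u _.
rewrite /F patchE/= indicE; case: ifPn => uI; last by rewrite mul0r.
by move: uI; rewrite inE/= in_itv/= mul1r => /andP[u0 _]; rewrite ger0_norm.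
Qed.

Variables (mu y : R) (B : R -> T -> R).
Hypothesis mB : forall s, 0 <= s -> measurable_fun setT (B s).
Hypothesis cB : continuous_paths B.

Lemma measurable_vertical t : 0 <= t -> measurable_fun setT (vertical mu y B t).
Proof.
move=> t0; apply: measurable_funM => //; apply: measurableT_comp => //.
by apply: measurable_funB => //; exact: mB.
Qed.

Lemma continuous_vertical_sqr w :
  {within `[0, +oo[, continuous (fun s => vertical mu y B s w ^+ 2)}.
Proof.
have cV : {within `[0, +oo[, continuous (fun s => vertical mu y B s w)}.
  move=> t; apply: cvgM; first exact: cvg_cst.
  apply: (@cvg_comp _ _ _ (fun s => B s w - mu * s) expR); last first.
    exact: continuous_expR.
  apply: cvgB; [exact: (nbhs_filter (t : subspace `[0, +oo[))|exact: cB|].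
  apply: continuous_subspaceT => u.
  by apply: cvgM; [exact: cvg_cst|exact: cvg_id].
rewrite (_ : (fun s => _) =
    (fun s => vertical mu y B s w * vertical mu y B s w)); last first.
  by apply/funext => s; rewrite expr2.
by move=> t; apply: cvgM; exact: cV.
Qed.

Lemma measurable_clock t : measurable_fun setT (clock mu y B t).
Proof.
apply: measurable_Rintegral_path => [s s0|w|s w]; last exact: sqr_ge0.
  by apply: measurable_funX; exact: measurable_vertical.
exact: continuous_vertical_sqr.
Qed.

Lemma clock_ge0 t w : 0 <= clock mu y B t w.
Proof. by apply: Rintegral_ge0 => s _; exact: sqr_ge0. Qed.

Lemma clock0 w : clock mu y B 0 w = 0.
Proof. by rewrite /clock set_itv1 Rintegral_set1. Qed.

Lemma clock_le s t w : s <= t -> clock mu y B s w <= clock mu y B t w.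
Proof.
move=> st.
(* The real-valued integral is the finite part of an extended one, so monotonicity requires
   finiteness; it comes from continuity on a compact interval. *)
have int u : lebesgue_measure.-integrable `[0, u]
    (EFin \o (fun s => vertical mu y B s w ^+ 2)).
  apply: continuous_compact_integrable; first exact: segment_compact.
  apply: (continuous_subspaceW _ (@continuous_vertical_sqr w)).
  by move=> r /=; rewrite !in_itv/= => /andP[->].
apply: fine_le; [exact: integrable_fin_num|exact: integrable_fin_num|].
apply: ge0_subset_integral => //.
- exact: measurable_int (int t).
- by move=> r _; rewrite lee_fin sqr_ge0.
- by move=> r /=; rewrite !in_itv/= => /andP[-> /le_trans]; apply.
Qed.

End clock.

Section time_change.
Context {R : realType} {d : measure_display} {T : measurableType d}.

Lemma measurable_sigma_process (S : Type) (M : set_system S)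
    (X : R -> T -> S) (t : R) d' (S' : measurableType d') (g : S -> S') :
  0 <= t -> (forall A, measurable A -> M (g @^-1` A)) ->
  measurable_fun [set: g_sigma_algebraType (sigma_process M X)] (g \o X t).
Proof.
move=> t0 Mg _ A mA; rewrite setTI; apply: sub_sigma_algebra.
exact: (sigma_process_time X t0 (Mg A mA)).
Qed.

Lemma measurable_sigma_processE (S : Type) (M : set_system S)
    (X : R -> T -> S) :
  (sigma_process M X).-sigma.-measurable = sigma_process M X.
Proof. exact/sigma_algebra_id/sigma_process_sigma_algebra. Qed.

Lemma borel_rV_coord n (i : 'I_n) (A : set R) :
  measurable A -> @borel_rV R n ((fun x : 'rV[R]_n => x ord0 i) @^-1` A).
Proof.
move=> mA; apply: sub_sigma_algebra.
rewrite (bigD1 i)//=; left.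
by exists A => //; rewrite setTI.
Qed.

Variables (P : probability T R) (m : nat) (mu y b0 : R) (b : 'rV[R]_m.+1)
  (B : R -> T -> R) (beta : R -> T -> 'rV[R]_m.+1).
Hypothesis bmB : brownian_motion P b0 B.
Hypothesis bmbeta : brownian_motion_rV P b beta.
Hypothesis indep : independent2 P (sigma_process (@borel_rV R m.+1) beta)
  (sigma_process measurable B).

Let X := time_changed mu y beta B.

Let mB t : 0 <= t -> measurable_fun setT (B t).
Proof. by move=> t0 _ A mA; rewrite setTI; have [pB _ _ _ _] := bmB; exact: pB. Qed.

Let cB : continuous_paths B.
Proof. by have [_ cB _ _ _] := bmB. Qed.

Let mbeta t i : 0 <= t -> measurable_fun setT (fun w => beta t w ord0 i).
Proof.
move=> t0 _ A mA; rewrite setTI.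
by have [pb _ _ _ _] := bmbeta.1 i; exact: pb.
Qed.

Let cbeta i w : {within `[0, +oo[, continuous (fun t => beta t w ord0 i)}.
Proof. by have [_ cb _ _ _] := bmbeta.1 i; exact: (cb w). Qed.

Let S := (real_family R (R * 'I_m.+1) * real_family R (R + R))%type.

(** The clock ([inl]) and the last coordinate ([inr]) together: all that is determined by [B], hence
    independent of [beta]. *)
Let e (w : T) : real_family R (R + R) :=
  fun k => match k with
           | inl t => clock mu y B `|t| w
           | inr t => vertical mu y B `|t| w
           end.

Let me : measurable_fun setT e.
Proof.
apply: measurable_family => -[t|t]; first exact: measurable_clock.
exact: measurable_vertical.
Qed.

(** Measurability of the clock and of the last coordinate holds for any sigma-algebra that makes
    each [B t], [0 <= t], measurable, in particular for the one generated by [B]. *)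
Let e_sigma E : measurable E -> sigma_process measurable B (e @^-1` E).
Proof.
move=> mE; rewrite -measurable_sigma_processE.
have mB' t : 0 <= t -> measurable_fun
    [set: g_sigma_algebraType (sigma_process measurable B)] (B t).
  move=> t0.
  exact: (@measurable_sigma_process R measurable B t _ R id t0 (fun _ mA => mA)).
suff me' : measurable_fun
    [set: g_sigma_algebraType (sigma_process measurable B)] e.
  exact: measurable_preimage me' mE.
apply: measurable_family => -[t|t]; first exact: measurable_clock.
exact: measurable_vertical.
Qed.

Let beta_sigma E : measurable E ->
  sigma_process (@borel_rV R m.+1) beta (coords beta @^-1` E).
Proof.
move=> mE; rewrite -measurable_sigma_processE.
suff mb' : measurable_fun
    [set: g_sigma_algebraType (sigma_process (@borel_rV R m.+1) beta)]
    (coords beta).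
  exact: measurable_preimage mb' mE.
apply: measurable_coords => t i t0.
exact: (@measurable_sigma_process _ _ beta t _ R (fun x => x ord0 i) t0
  (@borel_rV_coord m.+1 i)).
Qed.

Let mcb : measurable_fun setT (coords beta).
Proof. exact: measurable_coords. Qed.

(* Phi flips the space coordinates of (beta, (A, Y)); H n evaluates them at the
   clock, rounded down to the grid. *)
Let Phi n (k : nat) (p : S) : S := (mirror_coord (k%:R / n.+1%:R) p.1, p.2).

Let mPhi n k : measurable_fun setT (Phi n k).
Proof.
apply: measurable_fun_pair; last exact: measurable_snd.
by apply: measurableT_comp measurable_fst; exact: measurable_mirror_coord.
Qed.

(** Grid index of the clock at time [s]: flipping X after [s] is approximated by flipping [beta]
    after [k n s p / (n+1)], which is [A_s] rounded down. *)
Let k n s (p : S) := Num.truncn (n.+1%:R * p.2 (inl s)).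

Let mk n s i : measurable (k n s @^-1` [set i]).
Proof.
have mx : measurable_fun setT (fun p : S => n.+1%:R * p.2 (inl s)).
  apply: measurable_funM => //.
  exact: (measurableT_comp (measurable_coord _) measurable_snd).
exact: (measurable_preimage mx (measurable_truncn i)).
Qed.

Let H n (p : S) : real_family R (R * 'I_m.+2) :=
  fun ti => match unlift ord_max ti.2 with
            | Some j => p.1 (grid n (p.2 (inl ti.1)), j)
            | None => p.2 (inr ti.1)
            end.

Let mH n : measurable_fun setT (H n).
Proof.
apply: measurable_family => -[t i]; rewrite /H/=.
case: (unlift ord_max i) => [j|]; last first.
  exact: (measurableT_comp (measurable_coord _) measurable_snd).
apply: (measurable_fun_grid n (x := fun p : S => p.2 (inl t))
    (h := fun u (p : S) => p.1 (u, j))).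
  exact: (measurableT_comp (measurable_coord _) measurable_snd).
move=> u u0.
exact: (measurableT_comp (measurable_coord _) measurable_fst).
Qed.

Let mX : measurable_fun setT (coords X).
Proof.
pose F n w := H n (coords beta w, e w).
have mF n : measurable_fun setT (F n).
  by apply: measurableT_comp (mH n) _; exact: measurable_fun_pair.
apply: measurable_family => -[t i].
apply: (measurable_fun_cvg (h := fun n w => F n w (t, i))) => [n|w _].
  exact: measurableT_comp (measurable_coord _) (mF n).
rewrite /F /H /coords /= /X /time_changed /hyp_point mxE.
case: unliftP => [j _|_]; last exact: cvg_cst.
apply: (@within_cvg_seq _ (fun t => beta t w ord0 j)) => //.
- exact: clock_ge0.
- under eq_fun do rewrite (ger0_norm (grid_ge0 _ _)).
  by apply: grid_cvg; exact: clock_ge0.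
Qed.

Lemma time_changed_mirror s : 0 <= s ->
  eq_law P P (mirror_coord s \o coords X) (coords X).
Proof.
move=> s0.
pose f (w : T) : S := (coords beta w, e w).
have mf : measurable_fun setT f by exact: measurable_fun_pair.
pose Z n w := H n (Phi n (k n s (f w)) (f w)).
pose W n w := H n (f w).
have mZ n : measurable_fun setT (Z n).
  apply: measurableT_comp (mH n) _.
  apply: (measurable_fun_index (k := fun w => k n s (f w))
    (h := fun i w => Phi n i (f w))) => i.
    exact: measurable_preimage mf (mk n s i).
  exact: measurableT_comp (mPhi n i) mf.
have mW n : measurable_fun setT (W n) by exact: measurableT_comp (mH n) mf.
have ZW n : eq_law P P (Z n) (W n).
  (* The index is read off the second component, which [Phi] leaves alone. For each fixed index,
     independence reduces the claim to the mirror invariance of [beta]. *)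
  apply: (eq_law_comp (mH n)); apply: eq_law_index => // i.
  apply: (eq_law_pair indep) => //.
  - exact: measurableT_comp (measurable_mirror_coord _) mcb.
  - move=> E mE; have := measurable_preimage
      (measurable_mirror_coord (i%:R / n.+1%:R)) mE.
    exact: beta_sigma.
  - by apply: (brownian_motion_rV_mirror bmbeta); rewrite divr_ge0.
have betaE n t w j : coords beta w (grid n (clock mu y B t w), j) =
    beta (grid n (clock mu y B t w)) w ord0 j.
  by rewrite /coords/= (ger0_norm (grid_ge0 _ _)).
have cbg t w j : 0 <= t -> coords beta w (grid n (clock mu y B t w), j)
    @[n --> \oo] --> beta (clock mu y B t w) w ord0 j.
  move=> t0; under eq_fun do rewrite betaE.
  apply: (@within_cvg_seq _ (fun t => beta t w ord0 j)) => //.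
  - by move=> n; exact: grid_ge0.
  - exact: clock_ge0.
  - by apply: grid_cvg; exact: clock_ge0.
have XE w t i : coords X w (t, i) =
    match unlift ord_max i with
    | Some j => beta (clock mu y B `|t| w) w ord0 j
    | None => vertical mu y B `|t| w
    end.
  by rewrite /coords /X /time_changed /hyp_point /= mxE.
apply: (eq_law_lim (Zn := Z) (Wn := W) (G := setT)) => //.
- exact: measurableT_comp (measurable_mirror_coord _) mX.
- exact: probability_setT.
- move=> w [t i] _.
  rewrite [X in _ --> X](_ : _ = if i == ord0 then
      mirror s (fun t => coords X w (t, ord0)) `|t| else coords X w (t, i))//.
  rewrite /Z /H /=.
  case: (unliftP ord_max i) => [j ->|->]; last first.
    by rewrite /= XE unlift_none; exact: cvg_cst.
  have ij : (lift ord_max j == ord0 :> 'I_m.+2) = (j == ord0).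
    by rewrite -!val_eqE /= /bump leqNgt ltn_ord add0n.
  rewrite ij /mirror_coord /=; case: ifP => [_|_]; last first.
    rewrite XE liftK; exact: cbg.
  (* In dimension at least 2 the first coordinate is a horizontal one. *)
  have l0 : (ord0 : 'I_m.+2) = lift ord_max (ord0 : 'I_m.+1).
    by apply/val_inj.
  have ce u v : u <= v -> clock mu y B u w <= clock mu y B v w.
    by move=> uv; exact: clock_le.
  have kE n : (k n s (f w))%:R / n.+1%:R = grid n (clock mu y B s w).
    by rewrite /k /= (ger0_norm s0).
  under eq_fun do rewrite kE (ger0_norm (grid_ge0 _ _)).
  have X0E u : 0 <= u ->
      coords X w (u, ord0) = beta (clock mu y B u w) w ord0 ord0.
    by move=> u0; rewrite XE l0 liftK (ger0_norm u0).
  (* Clock and rounding are monotone, so the rounded [A_t] and [A_s] are ordered as [t] and [s].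
     They may coincide, but then both branches of [mirror] agree. *)
  have [ts|/ltW st] := leP `|t| s.
    rewrite mirror_le// X0E//.
    under eq_fun do rewrite mirror_le ?grid_le ?ce//.
    exact: cbg.
  rewrite mirror_ge// !X0E//.
  under eq_fun do rewrite mirror_ge ?grid_le ?ce// mulr2n.
  by rewrite mulr2n; apply: cvgB; [apply: cvgD|]; exact: cbg.
- move=> w [t i] _; rewrite XE /W /H /=.
  by case: (unlift ord_max i) => [j|]; [exact: cbg|exact: cvg_cst].
Qed.

Lemma time_changed_start : P [set w | X 0 w ord0 ord0 = b ord0 ord0] = 1%E.
Proof.
have [_ _ <- _ _] := bmbeta.1 ord0.
congr (P _); apply/seteqP; split => w /=;
  rewrite /X /time_changed /hyp_point mxE clock0;
  by rewrite (_ : ord0 = lift ord_max (ord0 : 'I_m.+1)) ?liftK//;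
    apply/val_inj.
Qed.

End time_change.

(** * Reflection at the exit time *)

Section path_families.
Context {R : realType}.

Lemma borel_rV_preimage d (T : measurableType d) n (g : T -> 'rV[R]_n) A :
  (forall i, measurable_fun setT (fun w => g w ord0 i)) ->
  borel_rV A -> measurable (g @^-1` A).
Proof.
move=> mg; suff : @borel_rV R n `<=` [set A | measurable (g @^-1` A)].
  by apply.
apply: smallest_sub => [|B].
  split => /= [|B mB|F mF].
  - by rewrite preimage_set0.
  - by rewrite setTD -preimage_setC; exact: measurableC.
  - by rewrite preimage_bigcup; exact: bigcupT_measurable.
elim/big_ind: _ => // [F G FP GP [/FP|/GP]//|i _ [C mC <-]].
rewrite setTI /=; exact: (measurable_preimage (mg i) mC).
Qed.

Definition family_of_path n (p : R -> 'rV[R]_n) : real_family R (R * 'I_n) :=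
  fun ti => p `|ti.1| ord0 ti.2.

Lemma path_sigma_family_of_path n (E : set (real_family R (R * 'I_n))) :
  measurable E -> path_sigma (@borel_rV R n) (@family_of_path n @^-1` E).
Proof.
move=> mE; pose G := [set C | exists t A, [/\ 0 <= t, @borel_rV R n A &
  C = [set p : R -> 'rV[R]_n | A (p t)]]].
have mf : measurable_fun [set: g_sigma_algebraType G] (@family_of_path n).
  apply: measurable_family => -[t i] _ A mA; rewrite setTI.
  apply: sub_sigma_algebra.
  exists `|t|, [set x : 'rV[R]_n | A (x ord0 i)]; split => //.
  exact: borel_rV_coord.
exact: (measurable_preimage mf mE).
Qed.

(** A generator looks at a single time [t >= 0], where [|t| = t], and the row [p t] is rebuilt from
    its coordinates. *)
Lemma path_sigmaE n (E : set (R -> 'rV[R]_n)) :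
  path_sigma (@borel_rV R n) E ->
  exists2 F : set (real_family R (R * 'I_n)), measurable F &
    E = @family_of_path n @^-1` F.
Proof.
move=> sE; suff [F mF <-] : preimage_set_system setT (@family_of_path n)
    (@measurable _ (real_family R (R * 'I_n))) E.
  by exists F => //; rewrite setTI.
move: E sE; apply: smallest_sub.
  apply: sigma_algebra_preimage.
  exact: (@sigma_algebra_measurable _ (real_family R (R * 'I_n))).
move=> _ [t [A [t0 bA ->]]].
pose row_at (e : real_family R (R * 'I_n)) : 'rV[R]_n := \row_j e (t, j).
exists (row_at @^-1` A).
  apply: borel_rV_preimage bA => i.
  have -> : (fun e => row_at e ord0 i) = (fun e => e (t, i)).
    by apply/funext => e; rewrite mxE.
  exact: measurable_coord.
rewrite setTI; apply/seteqP; split => p /=;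
  by rewrite (_ : row_at _ = p t)//; apply/rowP => j;
    rewrite mxE /family_of_path/= ger0_norm.
Qed.

Context {d d' : measure_display} {T : measurableType d} {T' : measurableType d'}.

Lemma is_process_coord n (X : R -> T -> 'rV[R]_n) t i :
  is_process (@borel_rV R n) X -> 0 <= t ->
  measurable_fun setT (fun w => X t w ord0 i).
Proof.
move=> pX t0 _ A mA; rewrite setTI.
exact: (pX _ _ t0 (borel_rV_coord i mA)).
Qed.

Lemma same_law_eq_law n (P : probability T R) (P' : probability T' R)
    (X : R -> T -> 'rV[R]_n) (X' : R -> T' -> 'rV[R]_n) :
  same_law (@borel_rV R n) P X P' X' -> eq_law P P' (coords X) (coords X').
Proof.
by move=> [_ _ XX'] E mE; exact: XX' (path_sigma_family_of_path mE).
Qed.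

Lemma eq_law_same_law n (P : probability T R) (P' : probability T' R)
    (X : R -> T -> 'rV[R]_n) (X' : R -> T' -> 'rV[R]_n) :
  is_process (@borel_rV R n) X -> is_process (@borel_rV R n) X' ->
  eq_law P P' (coords X) (coords X') -> same_law (@borel_rV R n) P X P' X'.
Proof.
move=> pX pX' XX'; split => // E /path_sigmaE[F mF ->].
exact: XX'.
Qed.

End path_families.

(** * Paths whose first coordinate has reached zero *)

Section hitting.
Context {R : realType} {m : nat}.
Notation fam := (real_family R (R * 'I_m.+1)).

(* For a continuous path: its first coordinate is <= 0 somewhere in ]0, u[.  Only
   countably many times may be used to get a measurable set. *)
Definition hit (u : R) : set fam := [set p | exists a : nat, forall k : nat,
  exists r : rat, [/\ a.+1%:R^-1 < ratr r :> R, ratr r < u - a.+1%:R^-1 &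
    p (ratr r, ord0) < k.+1%:R^-1]].

Lemma measurable_hit u : measurable (hit u).
Proof.
rewrite (_ : hit u = \bigcup_a \bigcap_k \bigcup_(r : rat)
    (if (a.+1%:R^-1 < ratr r :> R) && (ratr r < u - a.+1%:R^-1) then
      [set p : fam | p (ratr r, ord0) < k.+1%:R^-1] else set0)).
  apply: bigcupT_measurable => a; apply: bigcapT_measurable => k.
  apply: bigcupT_measurable_rat => r; case: ifP => // _.
  rewrite (_ : [set p : fam | _] =
      (fun p : fam => p (ratr r, ord0)) @^-1` `]-oo, k.+1%:R^-1[%classic).
    exact: (measurable_preimage (measurable_coord _) (measurable_itv _)).
  by apply/seteqP; split => p /=; rewrite in_itv.
apply/seteqP; split => p.
  move=> [a h]; exists a => // k _; have [r [r1 r2 r3]] := h k.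
  by exists r => //=; rewrite r1 r2.
move=> [a _ h]; exists a => k; have [r _] := h k Logic.I.
by case: ifP => // /andP[r1 r2] r3; exists r.
Qed.

(** Only times in []0, u[] are consulted. With [p = p'] this is monotonicity in the time; with
    [u = v] it shows that a flip at [u] or later goes unnoticed. *)
Lemma hit_local u v (p p' : fam) :
  (forall r, 0 < r -> r < u -> p (r, ord0) = p' (r, ord0)) ->
  u <= v -> hit u p -> hit v p'.
Proof.
move=> pp' uv [a h]; exists a => k; have [r [r1 r2 r3]] := h k.
have a0 : 0 < a.+1%:R^-1 :> R by [].
exists r; split => //; first by rewrite (lt_le_trans r2)// lerD2r.
rewrite -pp'//; first exact: lt_trans r1.
by rewrite (lt_trans r2)// ltrBlDr ltrDl.
Qed.

Lemma hit0 (p : fam) : ~ hit 0 p.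
Proof.
move=> [a /(_ 0%N) [r [r1 r2 _]]].
have a0 : 0 < a.+1%:R^-1 :> R by [].
by move: (lt_trans r1 r2); rewrite sub0r ltNge ltW// (lt_trans _ a0)// oppr_lt0.
Qed.

(** The margin 1/(a+1) at both ends leaves a compact interval, on which the minimum is attained;
    being below every 1/(k+1), it is at most 0. Conversely, near a zero or negative value continuity
    provides rational times. *)
Lemma hitP u (x : R -> R) (p : fam) :
  (forall t, 0 <= t -> p (t, ord0) = x t) ->
  {within `[0, +oo[, continuous x} ->
  hit u p <-> exists s, [/\ 0 < s, s < u & x s <= 0].
Proof.
move=> px cx; split.
  move=> [a h]; set l : R := a.+1%:R^-1 in h.
  have l0 : 0 < l by rewrite /l invr_gt0.
  have lu : l <= u - l.
    by have [r [r1 r2 _]] := h 0%N; rewrite ltW// (lt_trans r1 r2).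
  have [c /[!in_itv]/= /andP[lc cu] cmin] : exists2 c, c \in `[l, u - l]%R &
      forall t, t \in `[l, u - l]%R -> x c <= x t.
    apply: EVT_min => //; apply: continuous_subspaceW cx => t /=.
    by rewrite !in_itv/= => /andP[lt _]; rewrite (le_trans _ lt)// ltW.
  exists c; split.
  - exact: lt_le_trans lc.
  - by rewrite (le_lt_trans cu)// ltrBlDr ltrDl.
  - rewrite leNgt; apply/negP => xc.
    have [k _ /(_ k (leqnn k)) /= kx] :
        \forall k \near \oo, k.+1%:R^-1 < x c by exact: near_invS_lt.
    have [r [r1 r2]] := h k.
    rewrite px ?(le_trans _ (ltW r1))// ?ltW// => xr.
    have := cmin (ratr r); rewrite in_itv/= (ltW r1) (ltW r2) => /(_ isT).
    by rewrite leNgt (lt_trans xr kx).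
move=> [s [s0 su xs]].
have [a [as1 as2]] : exists a : nat, a.+1%:R^-1 < s /\ s < u - a.+1%:R^-1.
  have : 0 < Num.min s (u - s) by rewrite lt_min s0 subr_gt0.
  move=> /near_invS_lt[a _ /(_ a (leqnn a))].
  rewrite /= lt_min => /andP[a1 a2]; exists a; split => //.
  by rewrite ltrBrDr -ltrBrDl.
exists a => k.
have /subspace_continuousP/(_ s) := cx.
rewrite /= in_itv/= (ltW s0) => /(_ isT).
have xk : x s < k.+1%:R^-1 by rewrite (le_lt_trans xs).
move=> /cvgr_lt/(_ _ xk) /nbhs_ballP[e /= e0 xe].
have [r] : exists r : rat, ratr r \in
    `](Num.max a.+1%:R^-1 (s - e)), (Num.min (u - a.+1%:R^-1) (s + e))[.
  apply: rat_in_itvoo; move: (a.+1%:R^-1) as1 as2 => l as1 as2.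
  rewrite gt_max !lt_min; apply/andP; split; apply/andP; split; lra.
rewrite in_itv/= gt_max lt_min => /andP[/andP[r1 r2] /andP[r3 r4]].
have r0 : 0 <= ratr r :> R by rewrite (le_trans _ (ltW r1)).
exists r; split => //; rewrite px//; apply: xe; last by rewrite in_itv/= r0.
by rewrite /ball/= ltr_norml; apply/andP; split; lra.
Qed.

End hitting.

(** * Flipping at the first grid time after the hit *)

Section hit_index.
Context {R : realType} {m : nat}.
Notation fam := (real_family R (R * 'I_m.+1)).

(* The least k such that hit (k / (n + 1)); it is never 0, because hit 0 is empty,
   so that 0 encodes the absence of such a k. *)
Definition hit_index (n : nat) (p : fam) : nat :=
  match pselect (exists k, `[< hit (k%:R / n.+1%:R) p >]) with
  | left h => ex_minn h
  | right _ => 0%N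
  end.

(** Index 0 stands for a path that never hits, and then nothing is flipped. *)
Definition mirror_index (n k : nat) (p : fam) : fam :=
  if k is 0%N then p else mirror_coord (k%:R / n.+1%:R) p.

Let hit_mono n k l (p : fam) : (k <= l)%N ->
  hit (k%:R / n.+1%:R) p -> hit (l%:R / n.+1%:R) p.
Proof.
move=> kl; apply: hit_local => //.
by rewrite ler_pM2r ?invr_gt0// ler_nat.
Qed.

Lemma hit_index_eq0 n p :
  hit_index n p = 0%N <-> forall k, ~ hit (k%:R / n.+1%:R) p.
Proof.
rewrite /hit_index; case: pselect => [h|h]; last first.
  by split => // _ k hk; apply: h; exists k; exact/asboolP.
case: ex_minnP => k /asboolP hk _; split => [k0|/(_ k)//].
by exfalso; apply: (@hit0 R m p); move: hk; rewrite k0 mul0r.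
Qed.

(** [hit] is monotone in the time, so two consecutive grid times determine the least index. *)
Lemma hit_index_eqS n p k : hit_index n p = k.+1 <->
  hit (k.+1%:R / n.+1%:R) p /\ ~ hit (k%:R / n.+1%:R) p.
Proof.
rewrite /hit_index; case: pselect => [h|h]; last first.
  by split => // -[hk _]; exfalso; apply: h; exists k.+1; exact/asboolP.
case: ex_minnP => l /asboolP hl lmin; split => [lk|[hk nhk]].
  rewrite lk in hl lmin; split => // hk.
  by have := lmin k (asboolT hk); rewrite ltnn.
apply/eqP; rewrite eqn_leq lmin ?asboolT//= ltnNge; apply/negP => lk.
exact: nhk (hit_mono lk hl).
Qed.

Lemma measurable_hit_index n k : measurable (hit_index n @^-1` [set k]).
Proof.
case: k => [|k].
  rewrite (_ : _ @^-1` _ = \bigcap_k ~` hit (k%:R / n.+1%:R)).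
    by apply: bigcapT_measurable => k; apply: measurableC; exact: measurable_hit.
  apply/seteqP; split => p /=.
    by move=> /hit_index_eq0 h k _; exact: h.
  by move=> h; apply/hit_index_eq0 => k; exact: h.
rewrite (_ : _ @^-1` _ = hit (k.+1%:R / n.+1%:R) `\` hit (k%:R / n.+1%:R)).
  by apply: measurableD; exact: measurable_hit.
by apply/seteqP; split => p /= /hit_index_eqS.
Qed.

Lemma measurable_mirror_index n k : measurable_fun setT (mirror_index n k).
Proof.
by case: k => [|k]; [exact: measurable_id|exact: measurable_mirror_coord].
Qed.

(** The events at the grid times [k] and [k+1] depend only on the path strictly before
    [(k+1)/(n+1)], which the flip at that time preserves. This is the condition on the choice in
    [eq_law_index]. *)
Lemma hit_index_mirror n k p :
  hit_index n (mirror_index n k p) = k <-> hit_index n p = k.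
Proof.
case: k => [//|k].
have pE r : 0 < r -> r < k.+1%:R / n.+1%:R ->
    mirror_index n k.+1 p (r, ord0) = p (r, ord0).
  by move=> r0 rk; rewrite /mirror_index /mirror_coord/= ger0_norm ?mirror_le// ltW.
have kk : k%:R / n.+1%:R <= k.+1%:R / n.+1%:R :> R.
  by rewrite ler_pM2r ?invr_gt0// ler_nat.
have hE v : v <= k.+1%:R / n.+1%:R :> R ->
    hit v (mirror_index n k.+1 p) <-> hit v p.
  move=> vk; split; apply: hit_local => // r r0 rv; rewrite pE//;
  exact: lt_le_trans vk.
by rewrite !hit_index_eqS (hE _ (lexx _)) (hE _ kk).
Qed.

Lemma mirror_at_hit_eq_law d (T : measurableType d) (P : probability T R)
    (f : T -> fam) n :
  measurable_fun setT f ->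
  (forall s, 0 <= s -> eq_law P P (mirror_coord s \o f) f) ->
  eq_law P P (fun w => mirror_index n (hit_index n (f w)) (f w)) f.
Proof.
move=> mf mirrf; apply: eq_law_index => //.
- exact: measurable_hit_index.
- exact: measurable_mirror_index.
- by move=> k p; exact: hit_index_mirror.
- move=> [|k]; first by move=> E mE.
  by apply: mirrf; rewrite divr_ge0.
Qed.

(** The flip times [q n] decrease onto [tau], where [x] vanishes, so that [2 x(q n) - x T] tends to
    [- x T]. *)
Lemma hit_index_cvg (x : R -> R) (tau T : R) (p : fam) :
  (forall t, 0 <= t -> p (t, ord0) = x t) ->
  {within `[0, +oo[, continuous x} ->
  0 <= tau -> x tau = 0 -> 0 <= T -> tau <= T ->
  (forall u, hit u p <-> tau < u) ->
  mirror_index n (hit_index n p) p (T, ord0) @[n --> \oo] --> - x T.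
Proof.
move=> px cx tau0 xtau T0 tauT hitE.
pose q n : R := (hit_index n p)%:R / n.+1%:R.
(* The flip occurs strictly after [tau], at the first such grid time: its predecessor is at most
   [tau], which gives the upper bound. The truncation plus one witnesses that the index is not 0. *)
have hq n : [/\ (0 < hit_index n p)%N, tau < q n & q n <= tau + n.+1%:R^-1].
  rewrite /q; case E : (hit_index n p) => [|k].
    exfalso; move/hit_index_eq0: E => /(_ (Num.truncn (n.+1%:R * tau)).+1); apply.
    apply/hitE; rewrite ltr_pdivlMr// mulrC.
    have nt : 0 <= n.+1%:R * tau by exact: mulr_ge0.
    by have /andP[] := truncn_itv nt.
  move/hit_index_eqS : E => [/hitE h1 h2]; split => //.
  have : ~~ (tau < k%:R / n.+1%:R) by apply/negP => /hitE.
  by rewrite -leNgt -[k.+1%:R]natr1 mulrDl mul1r lerD2r.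
have pE n : mirror_index n (hit_index n p) p (T, ord0) = mirror (q n) x T.
  have [k0 qt _] := hq n.
  rewrite /mirror_index; move: k0 qt; rewrite /q.
  case: (hit_index n p) => // k _ qt.
  rewrite /mirror_coord/= (ger0_norm T0) /mirror !px//.
under eq_fun do rewrite pE.
have q0 n : 0 <= q n by have [_ qt _] := hq n; rewrite (le_trans tau0)// ltW.
have qtau : q n @[n --> \oo] --> tau.
  apply: (@squeeze_cvgr _ _ _ _ (cst tau) (fun n => tau + n.+1%:R^-1)).
  - by apply: nearW => n; have [_ qt ->] := hq n; rewrite andbT ltW.
  - exact: cvg_cst.
  - rewrite -[X in _ --> X]addr0; apply: cvgD; first exact: cvg_cst.
    exact: cvg_harmonic.
(* At [T = tau] the flip is still to come for every [n], and the unflipped value is 0, equal to its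
   opposite. *)
move: tauT; rewrite le_eqVlt => /predU1P[tauE|tauT].
  rewrite -tauE xtau oppr0.
  under eq_fun => n.
    rewrite mirror_le; last by have [_ /ltW] := hq n.
    rewrite xtau.
    over.
  exact: cvg_cst.
have : (x (q n) *+ 2 - x T) @[n --> \oo] --> - x T.
  rewrite -[X in _ --> X]sub0r; apply: cvgB; last exact: cvg_cst.
  rewrite -[X in _ --> X](mul0rn _ 2) -xtau.
  apply: cvgMn; exact: within_cvg_seq.
apply: cvg_trans; apply: near_eq_cvg.
near=> n; rewrite mirror_ge//.
by near: n; apply: cvgr_le qtau _ _.
Unshelve. all: by end_near. Qed.

End hit_index.

(** * The exit time and the limit of the flipped paths *)

Section reflection_at_exit.
Context {R : realType} {d : measure_display} {T : measurableType d}.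
Variables (P : probability T R) (m : nat) (X : R -> T -> 'rV[R]_m.+2).
Hypothesis cX : continuous_paths X.
Hypothesis HX : forall t w, 0 <= t -> half_space (X t w).
Hypothesis pX : is_process (@borel_rV R m.+2) X.

Let cx i w : {within `[0, +oo[, continuous (fun t => X t w ord0 i)}.
Proof.
move=> t; apply: (@cvg_comp _ _ _ (fun t => X t w) (fun v => v ord0 i)).
  exact: cX.
exact: coord_continuous.
Qed.

Let coordsE w t i : 0 <= t -> coords X w (t, i) = X t w ord0 i.
Proof. by move=> t0; rewrite /coords/= ger0_norm. Qed.

(** The path never leaves the half space, so it can leave [quarter_space] only through its first
    coordinate. An infimum is below [u] exactly when some element is. *)
Lemma hit_exit_time u w :
  hit u (coords X w) <-> (exit_time quarter_space X w < u%:E)%E.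
Proof.
have px t : 0 <= t -> coords X w (t, ord0) = X t w ord0 ord0 by exact: coordsE.
rewrite (hitP u px (cx (i := ord0) (w := w))); split.
  move=> [s [s0 su xs]]; apply/ereal_inf_ltP; exists s%:E; last by rewrite lte_fin.
  by exists s => //; split => // -[_ /=]; rewrite ltNge xs.
move=> /ereal_inf_ltP[_ [s [s0 Ds] <-]]; rewrite lte_fin => su.
exists s; split => //; rewrite leNgt; apply/negP => xs; apply: Ds.
by split => //; apply: HX; exact: ltW.
Qed.

Let mcoords : measurable_fun setT (coords X).
Proof. by apply: measurable_coords => t i; exact: is_process_coord. Qed.

(** The complement of [hit u] is the event that the exit time is at least [u]; the strict inequality
    is the union of these over [u = t + 1/(k+1)]. *)
Let measurable_exit t :
  measurable [set w | (t%:E < exit_time quarter_space X w)%E].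
Proof.
rewrite (_ : [set _ | _] =
    \bigcup_k ~` (coords X @^-1` hit (t + k.+1%:R^-1))).
  apply: bigcupT_measurable => k; apply: measurableC.
  exact: (measurable_preimage mcoords (measurable_hit _)).
apply/seteqP; split => w /=.
  move=> tw; have [k tk] : exists k,
      ((t + k.+1%:R^-1)%:E <= exit_time quarter_space X w)%E.
    case: (exit_time quarter_space X w) tw => [r| |] //=.
    - rewrite lte_fin -subr_gt0 => rt0.
      have [k _ /(_ k (leqnn k)) /= kr] := near_invS_lt rt0.
      by exists k; rewrite lee_fin -lerBrDl ltW.
    - by exists 0%N; rewrite leey.
  exists k => // /hit_exit_time.
  by rewrite ltNge tk.
move=> [k _ nh]; rewrite ltNge; apply/negP => et; apply: nh.
apply/hit_exit_time; apply: le_lt_trans et _.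
by rewrite lte_fin ltrDl.
Qed.

Let measurable_reflected t i : 0 <= t ->
  measurable_fun setT (fun w => reflected_at_exit X t w ord0 i).
Proof.
move=> t0; rewrite (_ : (fun w => _) = (fun w =>
    if (t%:E < exit_time quarter_space X w)%E then X t w ord0 i
    else if i == ord0 then - X t w ord0 i else X t w ord0 i)); last first.
  apply/funext => w; rewrite /reflected_at_exit; case: ifP => // _.
  by rewrite mxE.
have mXt : measurable_fun setT (fun w => X t w ord0 i).
  exact: is_process_coord.
apply: measurable_fun_ifT => //.
  apply: (@measurable_fun_bool _ _ _ _ true); rewrite setTI.
  exact: measurable_exit.
by case: (i == ord0) => //; exact: measurable_funN.
Qed.

Lemma is_process_reflected : is_process (@borel_rV R m.+2) (reflected_at_exit X).
Proof.
move=> t A t0 bA; apply: borel_rV_preimage bA => i.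
exact: measurable_reflected.
Qed.

(** Values at most 0 occur at [tau] or arbitrarily close to its right, giving [x tau <= 0]; values
    before [tau] are positive, giving [0 <= x tau]. *)
Let exit_coord_eq0 w (tau : R) : 0 < X 0 w ord0 ord0 -> 0 <= tau ->
  exit_time quarter_space X w = tau%:E -> X tau w ord0 ord0 = 0.
Proof.
move=> x0 tau0 tauE; pose x t := X t w ord0 ord0.
have near_tau e : 0 < e -> exists2 s, tau <= s < tau + e & x s <= 0.
  move=> e0; have : (exit_time quarter_space X w < (tau + e)%:E)%E.
    by rewrite tauE lte_fin ltrDl.
  move=> /ereal_inf_ltP[_ [s [s0 Ds] <-]]; rewrite lte_fin => su.
  exists s.
    rewrite su andbT -lee_fin -tauE; apply: ereal_inf_lbound.
    by exists s.
  rewrite leNgt; apply/negP => xs; apply: Ds.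
  by split => //; apply: HX; exact: ltW.
have before s : 0 < s -> s < tau -> 0 < x s.
  move=> s0 st; rewrite ltNge; apply/negP => xs.
  have : (exit_time quarter_space X w <= s%:E)%E.
    apply: ereal_inf_lbound; exists s => //; split => // -[_ /=].
    by rewrite ltNge xs.
  by rewrite tauE lee_fin leNgt st.
have /subspace_continuousP/(_ tau) := cx (i := ord0) (w := w).
rewrite /= in_itv/= tau0 => /(_ isT) ctau.
have le0 : x tau <= 0.
  rewrite leNgt; apply/negP => xtau.
  move: (ctau) => /cvgr_gt/(_ _ xtau)/nbhs_ballP[e /= e0 xe].
  have [s /andP[ts se] xs] := near_tau e e0.
  have : 0 < x s.
    apply: xe; last by rewrite in_itv/= (le_trans tau0 ts).
    by rewrite /ball/= ltr_norml; apply/andP; split; lra.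
  by rewrite ltNge xs.
(* Approaching from the left requires [0 < tau], and this is where the positive starting point
   enters. *)
have tau_gt0 : 0 < tau.
  by rewrite lt_neqAle tau0 andbT; apply: contraTneq le0 => <-; rewrite -ltNge.
apply/eqP; rewrite eq_le le0 /= leNgt; apply/negP => xtau.
move: (ctau) => /cvgr_lt/(_ _ xtau)/nbhs_ballP[e /= e0 xe].
(* A time within [e] of [tau] on its left, kept positive by [tau / 2]. *)
pose s := Num.max (tau - e / 2) (tau / 2).
have s0 : 0 < s by rewrite lt_max divr_gt0// orbT.
have st : s < tau by rewrite gt_max; apply/andP; split; lra.
have se : tau - e / 2 <= s by rewrite le_max lexx.
have := before s s0 st; rewrite ltNge => /negP; apply; apply: ltW.
apply: xe; last by rewrite in_itv/= ltW.
by rewrite /ball/= ltr_norml; apply/andP; split; lra.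
Qed.

Lemma reflected_same_law (x : 'rV[R]_m.+2) :
  0 < x ord0 ord0 ->
  P [set w | X 0 w ord0 ord0 = x ord0 ord0] = 1%E ->
  (forall s, 0 <= s -> eq_law P P (mirror_coord s \o coords X) (coords X)) ->
  same_law (@borel_rV R m.+2) P (reflected_at_exit X) P X.
Proof.
move=> x0 Px0 mirrX; apply: eq_law_same_law => //.
  exact: is_process_reflected.
pose k n w := hit_index n (coords X w).
pose Z n w := mirror_index n (k n w) (coords X w).
have mZ n : measurable_fun setT (Z n).
  apply: (measurable_fun_index (k := k n)
    (h := fun i w => mirror_index n i (coords X w))) => i.
    exact: (measurable_preimage mcoords (measurable_hit_index n i)).
  exact: (measurableT_comp (measurable_mirror_index n i) mcoords).
have mG : measurable [set w | X 0 w ord0 ord0 = x ord0 ord0].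
  exact: measurable_preimage (is_process_coord ord0 pX (lexx _))
    (measurable_set1 (x ord0 ord0)).
(* The start lies at [x] only almost surely, so convergence is established on that event. *)
apply: (eq_law_lim (Zn := Z) (Wn := fun _ => coords X) _ _ _ _ mG Px0) => //.
- by apply: measurable_coords => t i; exact: measurable_reflected.
- move=> w [t i] /= Gw.
  rewrite [X in _ --> X](_ : _ = reflected_at_exit X `|t| w ord0 i)//.
  have [->|i0] := eqVneq i ord0; last first.
    rewrite (_ : reflected_at_exit _ _ _ _ _ = coords X w (t, i)); last first.
      rewrite /reflected_at_exit; case: ifP => // _.
      by rewrite mxE (negbTE i0).
    under eq_fun => n.
      rewrite (_ : Z n w (t, i) = coords X w (t, i)); first over.
      by rewrite /Z /mirror_index; case: (k n w) => // l;
        rewrite /mirror_coord/= (negbTE i0).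
    exact: cvg_cst.
  have Zt n : Z n w (t, ord0) = Z n w (`|t|, ord0).
    rewrite /Z /mirror_index /mirror_coord /coords.
    by case: (k n w) => [|l]; rewrite /= normr_id.
  under eq_fun do rewrite Zt.
  (* Before the exit no [Z n] has been flipped yet: its flip time, if any, exceeds the exit time. *)
  have [tw|wt] := ltP (`|t|%:E) (exit_time quarter_space X w).
    rewrite /reflected_at_exit tw.
    under eq_fun => n.
      rewrite (_ : Z n w (`|t|, ord0) = X `|t| w ord0 ord0); first over.
      rewrite /Z /mirror_index; case E : (k n w) => [|l]; first exact: coordsE.
      move/hit_index_eqS : E => [/hit_exit_time h _].
      rewrite /mirror_coord/= normr_id mirror_le ?coordsE//.
      by have := lt_trans tw h; rewrite lte_fin => /ltW.
    exact: cvg_cst.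
  rewrite /reflected_at_exit ltNge wt/= mxE eqxx.
  have : (0 <= exit_time quarter_space X w)%E.
    apply: le_ereal_inf_tmp => _ [s [s0 _] <-].
    by rewrite lee_fin ltW.
  (* The exit time is at most [|t|] and nonnegative, hence a real number. *)
  case tauE : (exit_time quarter_space X w) wt => [tau| |] //=.
  rewrite !lee_fin => taut tau0.
  apply: (@hit_index_cvg _ _ (fun t => X t w ord0 ord0) tau) => //.
  + by move=> u u0; exact: coordsE.
  + by apply: exit_coord_eq0 => //; rewrite Gw.
  + move=> u; rewrite -lte_fin -tauE; exact: hit_exit_time.
- by move=> w i _; exact: cvg_cst.
- by move=> n; exact: (mirror_at_hit_eq_law n mcoords mirrX).
Qed.

End reflection_at_exit.

Theorem proposition4 (R : realType) (m : nat) (mu : R) (hmu : 0 < mu)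
    (d : measure_display) (Omega : measurableType d) (P : probability Omega R)
    (x : 'rV[R]_m.+2) (hx : quarter_space x)
    (X : R -> Omega -> 'rV[R]_m.+2)
    (hX : hyperbolic_brownian_motion P mu x X) :
  same_law (@borel_rV R m.+2) P (reflected_at_exit X) P X.
Proof.
have [cX HX [d0 [T0 [P0 [B [beta [bmB bmbeta indep sl]]]]]]] := hX.
have [pX _ _] := sl.
have XX' := same_law_eq_law sl.
have x0 : 0 < x ord0 ord0 by case: hx.
have bx : horizontal x ord0 ord0 = x ord0 ord0.
  by rewrite mxE (_ : lift ord_max ord0 = ord0)//; apply/val_inj.
apply: (@reflected_same_law _ _ _ _ _ _ cX HX pX x x0).
  (* The starting point and mirror invariance are properties of the law alone, so both pass from
     [(beta(A_t), Y_t)] to [X], which may live on another probability space. *)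
  have := time_changed_start mu (x ord0 ord_max) B bmbeta.
  rewrite bx => <-.
  pose F := [set p : real_family R (R * 'I_m.+2) | p (0, ord0) = x ord0 ord0].
  have mF : measurable F.
    exact: measurable_preimage (measurable_coord (0 : R, ord0 : 'I_m.+2))
      (measurable_set1 (x ord0 ord0)).
  have := XX' _ mF; congr (_ = _); congr (_ _);
    by apply/seteqP; split => w; rewrite /F /coords/= normr0.
move=> s s0 E mE.
have mM := measurable_mirror_coord (m := m.+1) s.
rewrite [LHS](XX' _ (measurable_preimage mM mE)) [RHS](XX' _ mE).
exact: (time_changed_mirror mu (x ord0 ord_max) bmB bmbeta indep s0 mE).
Qed.
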